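(* Let $n\geq 1$, let $U\subseteq\mathcal{M}_n$ be a domain (nonempty connected open set) containing the null matrix, and let $F:U\rightarrow\mathcal{M}_n$ be a function of class $\mathcal{C}^1$ (in the real sense) with $F(0)=0$ such that $$\rho(F(x)-F(y))=\rho(x-y)\qquad (x,y\in U).$$ Then there exist $\gamma\in\mathbb{C}$ with $|\gamma|=1$ and an invertible $u\in\mathcal{M}_n$ such that, with $H$ equal to either $\gamma^{-1}F$ or $\gamma^{-1}\overline{F}$, one has either $H(x)=uxu^{-1}$ for all $x\in U$, or $H(x)=ux^tu^{-1}$ for all $x\in U$.
   Context: $\mathcal{M}_n$ denotes the space of all complex $n\times n$ matrices. For $x\in\mathcal{M}_n$, $\rho(x)$ denotes its spectral radius (the maximum modulus of its eigenvalues) and $x^t$ its transpose. The map $\overline{F}:U\to\mathcal{M}_n$ is defined by $\overline{F}(x)=\overline{F(x)}$, the matrix obtained from $F(x)$ by entrywise complex conjugation. *)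

(* Defs.v *)
From Stdlib Require Import Reals ClassicalEpsilon.
From mathcomp Require Import ssreflect ssrbool ssrfun eqtype ssrnat fintype bigop.

Set Implicit Arguments.
Unset Strict Implicit.

Open Scope R_scope.

Definition Cplx := (R * R)%type.
Definition C0 : Cplx := (0, 0).
Definition C1 : Cplx := (1, 0).
Definition Cadd (z w : Cplx) : Cplx := (fst z + fst w, snd z + snd w).
Definition Copp (z : Cplx) : Cplx := (- fst z, - snd z).
Definition Csub (z w : Cplx) : Cplx := Cadd z (Copp w).
Definition Cmul (z w : Cplx) : Cplx :=
  (fst z * fst w - snd z * snd w, fst z * snd w + snd z * fst w).
Definition Cconj (z : Cplx) : Cplx := (fst z, - snd z).
Definition Cmod (z : Cplx) : R := sqrt (fst z * fst z + snd z * snd z).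
Definition Cinv (z : Cplx) : Cplx :=
  let d := fst z * fst z + snd z * snd z in (fst z / d, - snd z / d).
Definition RtoC (r : R) : Cplx := (r, 0).

Definition Mat (n : nat) := 'I_n -> 'I_n -> Cplx.

Definition mzero (n : nat) : Mat n := fun _ _ => C0.
Definition mid (n : nat) : Mat n := fun i j => if i == j then C1 else C0.
Definition madd n (A B : Mat n) : Mat n := fun i j => Cadd (A i j) (B i j).
Definition msub n (A B : Mat n) : Mat n := fun i j => Csub (A i j) (B i j).
Definition mscale n (c : Cplx) (A : Mat n) : Mat n := fun i j => Cmul c (A i j).
Definition mRscale n (r : R) (A : Mat n) : Mat n := mscale (RtoC r) A.
Definition mmul n (A B : Mat n) : Mat n :=
  fun i j => \big[Cadd/C0]_(k < n) Cmul (A i k) (B k j).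
Definition mtr n (A : Mat n) : Mat n := fun i j => A j i.
Definition mconj n (A : Mat n) : Mat n := fun i j => Cconj (A i j).

(* max-norm on M_n = R^(2n^2) (all norms are equivalent) *)
Definition mnorm n (A : Mat n) : R :=
  \big[Rmax/0]_(i < n) \big[Rmax/0]_(j < n) Cmod (A i j).

Definition eigenvalue n (A : Mat n) (l : Cplx) : Prop :=
  exists v : 'I_n -> Cplx, (exists i, v i <> C0) /\
    forall i, \big[Cadd/C0]_(k < n) Cmul (A i k) (v k) = Cmul l (v i).

(* rho A = sup { |l| : l eigenvalue of A }  (a maximum, since the spectrum
   is finite and nonempty for n >= 1) *)
Definition rho n (A : Mat n) : R :=
  epsilon (inhabits 0)
    (fun r => is_lub (fun t => exists l, eigenvalue A l /\ t = Cmod l) r).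

Definition open_set n (U : Mat n -> Prop) : Prop :=
  forall x, U x -> exists eps, 0 < eps /\
    forall y, mnorm (msub y x) < eps -> U y.

Definition connected_set n (U : Mat n -> Prop) : Prop :=
  forall A B : Mat n -> Prop, open_set A -> open_set B ->
    (forall x, U x -> A x \/ B x) ->
    (exists x, U x /\ A x) -> (exists x, U x /\ B x) ->
    exists x, U x /\ A x /\ B x.

Definition domain n (U : Mat n -> Prop) : Prop :=
  (exists x, U x) /\ open_set U /\ connected_set U.

Definition R_linear n (L : Mat n -> Mat n) : Prop :=
  (forall a b, L (madd a b) = madd (L a) (L b)) /\
  (forall (r : R) a, L (mRscale r a) = mRscale r (L a)).

Definition frechet_at n (U : Mat n -> Prop) (F : Mat n -> Mat n)
    (x : Mat n) (L : Mat n -> Mat n) : Prop :=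
  R_linear L /\
  forall eps, 0 < eps -> exists delta, 0 < delta /\
    forall h, mnorm h < delta -> U (madd x h) ->
      mnorm (msub (msub (F (madd x h)) (F x)) (L h)) <= eps * mnorm h.

Definition C1_on n (U : Mat n -> Prop) (F : Mat n -> Mat n) : Prop :=
  exists DF : Mat n -> Mat n -> Mat n,
    (forall x, U x -> frechet_at U F x (DF x)) /\
    (forall x, U x -> forall eps, 0 < eps -> exists delta, 0 < delta /\
       forall y, U y -> mnorm (msub y x) < delta ->
         forall h, mnorm (msub (DF y h) (DF x h)) <= eps * mnorm h).

Arguments mzero n : clear implicits.
Arguments mid n : clear implicits.

(* Main.v *)
Require Import Defs.
From HB Require Import structures.
From Stdlib Require Import Reals ClassicalEpsilon.
From mathcomp Require Import all_boot all_order all_algebra fingroup perm.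
From mathcomp Require Import complex spectral.
From mathcomp Require Import ring lra.
From mathcomp Require Import boolp Rstruct.

(** The isometry identity first passes to the derivative [L] of [F] at a point:
    by continuity of the spectral radius, [specrad (L h) = specrad h].  Bounding
    [tr] and [tr (x ^ 2)] by the spectral radius, one sees that [L] preserves
    the trace zero matrices and the scalar matrices.  Integrating along
    segments, [F (q + c) = F q + a c] for scalars [c], where [a] is a plane
    isometry which is the same for all [q] near a given point; after multiplying
    by a unimodular constant and possibly conjugating, [a c = c].  Then
    [specrad (c + F x - F y) = specrad (c + x - y)] for all small scalars [c].
    If the eigenvalues of [(x - y) / t] are close to [n] distinct points of the
    unit circle, this identity determines the spectrum of [F x - F y], so that
    [tr ((F x - F y) ^ 2) = tr ((x - y) ^ 2)].  Polarizing with suitable base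
    points shows that [F] is affine near every point, hence linear on [U] by
    connectedness.  For linear [F] polarizing the traces of squares and cubes
    gives [F (h ^ 2) = (F h) ^ 2], and a Jordan automorphism of the matrix algebra
    is an inner automorphism, possibly composed with transposition. *)

Set Implicit Arguments.
Unset Strict Implicit.
Unset Printing Implicit Defensive.
Import Order.TTheory GRing.Theory Num.Theory ComplexField Normc.
Local Open Scope ring_scope.
Local Open Scope complex_scope.
Local Notation Re := complex.Re.
Local Notation Im := complex.Im.

(** * Spectrum and spectral radius *)

(** The hypothesis gives one real number for each pair of points, far less than a spectrum, and the
    derivative of [F] is only real linear. Scalar shifts are the way to individual eigenvalues: the
    modulus of [c + lam], for [c] in an open set, determines [lam]. Such shifts become available
    once [F] is known to commute with small scalars up to a plane isometry. This isometry cannot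
    vary with the base point because the trace of [F] does not change along short traceless
    segments, so that locally it depends only on the trace of the argument. The shift argument needs
    well separated eigenvalues, hence a reference matrix [D]. As only differences [F x - F y] are
    controlled, [x] and [y] move independently near two base points that differ by a multiple of
    [D]. Squares suffice for linearity since the trace form is nondegenerate; cubes bring in the
    product, because the pairings [tr (h k)] and [tr (h ^ 2 k)], together with surjectivity, pin
    down [F (h ^ 2)]. *)

Section Modulus.
Variable R : rcfType.
Implicit Types z w : R[i].

Lemma normc_ge0 z : 0 <= normc z.
Proof. by case: z => a b; apply: sqrtr_ge0. Qed.

Lemma normc_triangle z w : normc (z + w) <= normc z + normc w.
Proof. exact: le_normcD. Qed.

Lemma normc_opp z : normc (- z) = normc z.
Proof. exact: normcN. Qed.

Lemma normc_distC z w : normc (z - w) = normc (w - z).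
Proof. by rewrite -normc_opp opprB. Qed.

Lemma normc_real (a : R) : normc a%:C = `|a|.
Proof. by rewrite /= expr0n addr0 sqrtr_sqr. Qed.

Lemma normc_eq0 z : (normc z == 0) = (z == 0).
Proof. by apply/eqP/eqP => [/eq0_normc//|->]; rewrite normc0. Qed.

Lemma normc_gt0 z : (0 < normc z) = (z != 0).
Proof. by rewrite lt_neqAle normc_ge0 andbT eq_sym normc_eq0. Qed.

Lemma normc_conj z : normc (conjc z) = normc z.
Proof. by case: z => a b /=; rewrite sqrrN. Qed.

Lemma normc_Re z : `|Re z| <= normc z.
Proof.
case: z => a b /=; rewrite -sqrtr_sqr ler_wsqrtr //; have := sqr_ge0 b; lra.
Qed.

Lemma sqr_normcE z : normc z ^+ 2 = Re z ^+ 2 + Im z ^+ 2.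
Proof. by case: z => a b; rewrite /= sqr_sqrtr // addr_ge0 ?sqr_ge0. Qed.

Lemma normc_sum (I : Type) (r : seq I) (P : pred I) (f : I -> R[i]) :
  normc (\sum_(i <- r | P i) f i) <= \sum_(i <- r | P i) normc (f i).
Proof.
elim/big_rec2: _ => [|i x y _ le_yx]; first by rewrite normc0.
by apply: le_trans (normc_triangle _ _) _; rewrite lerD2l.
Qed.

Lemma normc_prod (I : Type) (r : seq I) (P : pred I) (f : I -> R[i]) :
  normc (\prod_(i <- r | P i) f i) = \prod_(i <- r | P i) normc (f i).
Proof. by apply: (big_morph _ (@normcM R) (@normc1 R)). Qed.

Lemma normcX z k : normc (z ^+ k) = normc z ^+ k.
Proof.
elim: k => [|k IH]; first by rewrite !expr0 normc1.
by rewrite !exprS normcM IH.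
Qed.

Lemma normc_sign (b : bool) : normc ((-1) ^+ b : R[i]) = 1.
Proof. by rewrite normcX normc_opp normc1 expr1n. Qed.

End Modulus.

Section Spectrum.
Variables (R : rcfType) (n : nat).
Local Notation C := R[i].
Local Notation M := 'M[C]_n.+1.
Implicit Types A B N : M.

(** The list carries multiplicities, so that sums of powers over it are traces. *)
Definition spectrum A : seq C := sval (closed_field_poly_normal (char_poly A)).

Lemma char_poly_spectrum A :
  char_poly A = \prod_(z <- spectrum A) ('X - z%:P).
Proof.
rewrite /spectrum; case: closed_field_poly_normal => s /= {1}->.
by rewrite (monicP (char_poly_monic A)) scale1r.
Qed.

Lemma size_spectrum A : size (spectrum A) = n.+1.
Proof.
by have := size_char_poly A; rewrite char_poly_spectrum size_prod_XsubC => -[].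
Qed.

Lemma mem_spectrum A z : (z \in spectrum A) = eigenvalue A z.
Proof. by rewrite eigenvalue_root_char char_poly_spectrum root_prod_XsubC. Qed.

Lemma trig_mulE A B : is_trig_mx A -> is_trig_mx B ->
  is_trig_mx (A *m B) /\ (forall i, (A *m B) i i = A i i * B i i).
Proof.
move=> /is_trig_mxP tA /is_trig_mxP tB; split.
  apply/is_trig_mxP => i j ij; rewrite mxE big1 // => k _.
  case: (ltnP i k) => ik; first by rewrite tA // mul0r.
  by rewrite tB ?mulr0 //; apply: leq_ltn_trans ij.
move=> i; rewrite mxE (bigD1 i) //= big1 ?addr0 // => k ki.
case: (ltngtP i k) => ik; first by rewrite tA // mul0r.
  by rewrite tB ?mulr0.
by rewrite (val_inj ik) eqxx in ki.
Qed.

Lemma char_poly_similar P A : P \in unitmx ->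
  char_poly (P *m A *m invmx P) = char_poly A.
Proof.
move=> Pu; rewrite /char_poly.
have -> : char_poly_mx (P *m A *m invmx P) =
    map_mx polyC P *m char_poly_mx A *m map_mx polyC (invmx P).
  rewrite /char_poly_mx mulmxBr mulmxBl -!map_mxM; congr (_ - _).
  rewrite mul_mx_scalar -scalemxAl -map_mxM mulmxV // map_mx1.
  by rewrite scalemx1.
by rewrite !det_mulmx mulrAC -det_mulmx -map_mxM mulmxV // map_mx1 det1 mul1r.
Qed.

(** Schur's unitary triangularization. The diagonal is the spectrum with multiplicities because both
    lists factor the same characteristic polynomial. *)
Lemma spectrum_triangular A : exists2 T : M,
  is_trig_mx T /\ perm_eq (spectrum A) [seq T i i | i <- enum 'I_n.+1] &
  exists2 P : M, P \in unitmx & A = invmx P *m T *m P.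
Proof.
have [P Pu /is_trig_mxP tT] := @Schur _ _ A isT.
have Pu' : P \in unitmx by apply: unitarymx_unit.
have cP : conjmx P A = P *m A *m invmx P by apply: conjumx.
exists (P *m A *m invmx P); last first.
  by exists P; rewrite // !mulmxA mulVmx // mul1mx mulmxKV.
have tT' : is_trig_mx (P *m A *m invmx P) by rewrite -cP; apply/is_trig_mxP.
split=> //.
apply: prod_XsubC_eq; rewrite -char_poly_spectrum big_map big_enum /=.
by rewrite -(char_poly_trig tT') (char_poly_similar A Pu').
Qed.

(** Powers of a triangular matrix have the powers of its diagonal entries on the diagonal, and
    traces do not see the conjugation. *)
Lemma mxtrace_spectrum A : [/\ \tr A = \sum_(z <- spectrum A) z,
  \tr (A *m A) = \sum_(z <- spectrum A) z ^+ 2 &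
  \tr (A *m A *m A) = \sum_(z <- spectrum A) z ^+ 3].
Proof.
have [T [tT pT] [P Pu eA]] := spectrum_triangular A.
have [tT2 dT2] := trig_mulE tT tT; have [tT3 dT3] := trig_mulE tT2 tT.
have sE (f : C -> C) : \sum_(z <- spectrum A) f z = \sum_i f (T i i).
  by rewrite (perm_big _ pT) /= big_map big_enum.
have cE X : \tr (invmx P *m X *m P) = \tr X.
  by rewrite -mulmxA mxtrace_mulC -mulmxA mulmxV // mulmx1.
have e2 : A *m A = invmx P *m (T *m T) *m P by rewrite eA !mulmxA mulmxK.
have e3 : A *m A *m A = invmx P *m (T *m T *m T) *m P.
  by rewrite e2 {1}eA !mulmxA mulmxK.
have e1 : \tr A = \tr T by rewrite [in LHS]eA cE.
split; first by rewrite e1 (sE id).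
  by rewrite e2 cE (sE (fun z => z ^+ 2)); apply: eq_bigr => i _; rewrite dT2 expr2.
rewrite e3 cE (sE (fun z => z ^+ 3)); apply: eq_bigr => i _.
by rewrite dT3 dT2 !exprS mulr1 mulrA.
Qed.

(** The default 0 never matters: the list has [n.+1] elements and moduli are nonnegative. *)
Definition specrad A : R := \big[Num.max/0]_(z <- spectrum A) normc z.

Lemma specrad_ub A z : eigenvalue A z -> normc z <= specrad A.
Proof. by rewrite -mem_spectrum => zA; apply: le_bigmax_seq. Qed.

Lemma specrad_attained A : exists2 z, eigenvalue A z & normc z = specrad A.
Proof.
suff H : forall s : seq C, (0 < size s)%N ->
    exists2 z, z \in s & normc z = \big[Num.max/0]_(z <- s) normc z.
  by have [|z] := H (spectrum A); rewrite ?size_spectrum // mem_spectrum; exists z.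
elim=> // x [_ _|y s /(_ isT) [z zs Ez] _].
  by exists x; rewrite ?mem_head // big_cons big_nil max_l ?normc_ge0.
rewrite big_cons -Ez; case: (leP (normc x) (normc z)) => _; last first.
  by exists x; rewrite ?mem_head.
by exists z; rewrite // inE zs orbT.
Qed.

Lemma specrad_ge0 A : 0 <= specrad A.
Proof. by have [z _ <-] := specrad_attained A; apply: normc_ge0. Qed.

Lemma specrad_eqP A r : (exists2 z, eigenvalue A z & normc z = r) ->
  (forall z, eigenvalue A z -> normc z <= r) -> specrad A = r.
Proof.
move=> [z zA <-] ub; apply/le_anti/andP; split; last exact: specrad_ub.
by have [w wA <-] := specrad_attained A; apply: ub.
Qed.

Lemma normc_mxtrace A : normc (\tr A) <= n.+1%:R * specrad A.
Proof.
have [-> _ _] := mxtrace_spectrum A; apply: le_trans (normc_sum _ _ _) _.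
rewrite -(size_spectrum A) mulr_natl.
have: forall z, z \in spectrum A -> normc z <= specrad A.
  by move=> z; rewrite mem_spectrum; apply: specrad_ub.
elim: (spectrum A) => [|x s IH] H; first by rewrite big_nil.
rewrite big_cons mulrS lerD ?H ?mem_head // IH // => z zs.
by rewrite H // inE zs orbT.
Qed.

Lemma normc_mxtrace_sqr A : normc (\tr (A *m A)) <= n.+1%:R * specrad A ^+ 2.
Proof.
have [_ -> _] := mxtrace_spectrum A; apply: le_trans (normc_sum _ _ _) _.
rewrite -(size_spectrum A) mulr_natl.
have: forall z, z \in spectrum A -> normc z <= specrad A.
  by move=> z; rewrite mem_spectrum; apply: specrad_ub.
elim: (spectrum A) => [|x s IH] H; first by rewrite big_nil.
rewrite big_cons mulrS lerD ?normcX //.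
  by rewrite ler_pXn2r ?nnegrE ?normc_ge0 ?specrad_ge0 ?H ?mem_head.
by rewrite IH // => z zs; rewrite H // inE zs orbT.
Qed.

Lemma eigenvalueZ A z c : eigenvalue A z -> eigenvalue (c *: A) (c * z).
Proof.
move=> /eigenvalueP [v Av vn0]; apply/eigenvalueP; exists v => //.
by rewrite -scalemxAr Av scalerA.
Qed.

Lemma eigenvalueDscalar A z c : eigenvalue A z -> eigenvalue (c%:M + A) (c + z).
Proof.
move=> /eigenvalueP [v Av vn0]; apply/eigenvalueP; exists v => //.
by rewrite mulmxDr Av mul_mx_scalar scalerDl.
Qed.

Lemma eigenvalue_addscalar A z c :
  eigenvalue (c%:M + A) (c + z) = eigenvalue A z.
Proof.
apply/idP/idP; last exact: eigenvalueDscalar.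
by move=> /(eigenvalueDscalar (- c)); rewrite raddfN /= !addKr.
Qed.

Lemma specradZ c A : specrad (c *: A) = normc c * specrad A.
Proof.
have [->|c0] := eqVneq c 0.
  rewrite scale0r normc0 mul0r; apply: specrad_eqP => [|z].
    exists 0; rewrite ?normc0 //; apply/eigenvalueP; exists (const_mx 1).
      by rewrite mulmx0 scale0r.
    by apply/eqP => /matrixP /(_ 0 0); rewrite !mxE => /eqP; rewrite oner_eq0.
  move=> /eigenvalueP [v]; rewrite mulmx0 => /esym/eqP.
  by rewrite scaler_eq0 orbC => /orP[-> //|/eqP-> _]; rewrite normc0.
apply: specrad_eqP => [|z].
  have [z zA <-] := specrad_attained A; exists (c * z); last exact: normcM.
  exact: eigenvalueZ.
move=> /(eigenvalueZ c^-1); rewrite scalerA mulVf // scale1r => /specrad_ub.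
by rewrite normcM normcV mulrC ler_pdivrMr ?normc_gt0 // mulrC.
Qed.

Lemma specrad_scalar c : specrad c%:M = normc c.
Proof.
have e0 : \row_(j < n.+1) (1 : C) != 0.
  by apply/eqP => /matrixP /(_ 0 0); rewrite !mxE => /eqP; rewrite oner_eq0.
apply: specrad_eqP => [|z].
  by exists c => //; apply/eigenvalueP; exists (\row_j 1) => //; rewrite mul_mx_scalar.
move=> /eigenvalueP [v]; rewrite mul_mx_scalar => /eqP.
rewrite -subr_eq0 -scalerBl scaler_eq0 => /orP[|/eqP-> /eqP //].
by rewrite subr_eq0 => /eqP ->.
Qed.

Lemma specrad0 : specrad 0 = 0.
Proof. by have := specrad_scalar 0; rewrite raddf0 normc0. Qed.

Lemma specrad_addscalar_nil c A : specrad A = 0 -> specrad (c%:M + A) = normc c.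
Proof.
move=> A0; have z0 z : eigenvalue A z -> z = 0.
  by move=> /specrad_ub; rewrite A0 => z0; apply/eqP; rewrite -normc_eq0 eq_le z0 normc_ge0.
apply: specrad_eqP => [|z].
  have [z zA _] := specrad_attained A.
  by have := eigenvalueDscalar c zA; rewrite (z0 z zA) addr0; exists c.
rewrite -{1}[z](subrKC c) eigenvalue_addscalar => /z0 /eqP.
by rewrite subr_eq0 => /eqP ->.
Qed.

Lemma specrad_sqr0 A : A *m A = 0 -> specrad A = 0.
Proof.
move=> A2; have [z /eigenvalueP [v Av vn0] <-] := specrad_attained A.
have : v *m A *m A = 0 by rewrite -mulmxA A2 mulmx0.
rewrite Av -scalemxAl Av scalerA => /eqP; rewrite scaler_eq0 (negPf vn0) orbF.
by rewrite mulf_eq0 orbb => /eqP ->; rewrite normc0.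
Qed.

Lemma specrad_conj A : specrad (map_mx (@conjc R) A) = specrad A.
Proof.
have conjE X z : eigenvalue X z -> eigenvalue (map_mx (@conjc R) X) (conjc z).
  move=> /eigenvalueP [v Xv vn0]; apply/eigenvalueP; exists (map_mx (@conjc R) v).
    by rewrite -map_mxM Xv map_mxZ.
  by rewrite map_mx_eq0.
have KA : map_mx (@conjc R) (map_mx (@conjc R) A) = A.
  by apply/matrixP => i j; rewrite !mxE conjcK.
apply: specrad_eqP => [|z /conjE].
  have [z zA <-] := specrad_attained A.
  by exists (conjc z); [apply: conjE | rewrite normc_conj].
by rewrite KA => /specrad_ub; rewrite normc_conj.
Qed.

Lemma horner_char_poly A z : (char_poly A).[z] = \det (z%:M - A).
Proof.
rewrite horner_sum; apply: eq_bigr => s _.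
rewrite hornerM horner_exp !hornerE; congr (_ * _).
rewrite (big_morph _ (fun p q => hornerM p q z) (hornerC 1 z)).
by apply: eq_bigr => i _; rewrite !mxE !(hornerE, hornerMn).
Qed.

End Spectrum.

Lemma pos_family_lb (R : rcfType) (T : finType) (f : T -> R) :
  (forall x, 0 < f x) -> exists2 e, 0 < e & forall x, e <= f x.
Proof.
move=> f0; exists (\big[Num.min/1]_x f x).
  by apply/bigmin_gtP; split.
by move=> x; apply: bigmin_le_cond.
Qed.

(** * Continuity of the spectrum, and its recovery from shifted spectral radii *)

Section SpectralVariation.
Variable R : rcfType.
Local Notation C := R[i].

(** Telescoping: the factors are exchanged one at a time, through
    [a p - b q = (a - b) p + b (p - q)]. *)
Lemma normc_prod_sub (I : Type) (r : seq I) (a b : I -> C) (K d : R) :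
    1 <= K -> (forall i, normc (a i) <= K) -> (forall i, normc (b i) <= K) ->
    (forall i, normc (a i - b i) <= d) ->
  normc (\prod_(i <- r) a i - \prod_(i <- r) b i) <=
    (size r)%:R * K ^+ size r * d.
Proof.
move=> K1 aK bK abd; elim: r => [|i r IH].
  by rewrite !big_nil subrr normc0 !mul0r.
rewrite !big_cons /=; set p := \prod_(i <- r) a i; set q := \prod_(i <- r) b i.
have -> : a i * p - b i * q = (a i - b i) * p + b i * (p - q) by ring.
have K0 : 0 <= K by lra.
have d0 : 0 <= d by apply: le_trans (normc_ge0 _) (abd i).
have pK : normc p <= K ^+ size r.
  rewrite /p normc_prod; elim: (r) => [|j s IHs]; first by rewrite big_nil.
  by rewrite big_cons exprS ler_pM ?normc_ge0 // -normc_prod normc_ge0.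
have Ks : 0 <= K ^+ size r by apply: exprn_ge0.
have nr : 0 <= (size r)%:R :> R by apply: ler0n.
apply: le_trans (normc_triangle _ _) _; rewrite !normcM.
have h1 : normc (a i - b i) * normc p <= d * K ^+ size r.
  by apply: ler_pM; rewrite ?normc_ge0.
have h2 : normc (b i) * normc (p - q) <= K * ((size r)%:R * K ^+ size r * d).
  by apply: ler_pM; rewrite ?normc_ge0.
have h3 : d * K ^+ size r <= d * K ^+ size r * K by rewrite ler_peMr // mulr_ge0.
rewrite exprS -natr1.
have -> : ((size r)%:R + 1) * (K * K ^+ size r) * d =
  K * ((size r)%:R * K ^+ size r * d) + d * K ^+ size r * K by ring.
lra.
Qed.

Lemma det_lipschitz n (K : R) : 1 <= K -> exists2 c : R, 0 < c &
  forall (A B : 'M[C]_n.+1) (d : R), (forall i j, normc (A i j) <= K) ->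
    (forall i j, normc (B i j) <= K) ->
    (forall i j, normc (A i j - B i j) <= d) ->
  normc (\det A - \det B) <= c * d.
Proof.
move=> K1; have K0 : 0 <= K by lra.
pose c := \sum_(s : {perm 'I_n.+1}) (n.+1%:R * K ^+ n.+1 : R).
have c0 : 0 <= c by apply: sumr_ge0 => s _; rewrite mulr_ge0 ?ler0n ?exprn_ge0.
exists (c + 1); first by lra.
move=> A B d AK BK ABd.
have d0 : 0 <= d by apply: le_trans (normc_ge0 _) (ABd 0 0).
have : normc (\det A - \det B) <= c * d; last by nra.
rewrite /determinant -sumrB /c mulr_suml.
apply: le_trans (normc_sum _ _ _) _; apply: ler_sum => s _.
rewrite -mulrBr normcM normc_sign mul1r.
have := @normc_prod_sub _ (index_enum 'I_n.+1) (fun i => A i (s i))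
  (fun i => B i (s i)) K d K1 (fun i => AK _ _) (fun i => BK _ _)
  (fun i => ABd _ _).
by rewrite -[index_enum _]enumT size_enum_ord.
Qed.

Variable n : nat.
Local Notation M := 'M[C]_n.+1.
Implicit Types A B : M.

(** Compare both sides of [v A = z v] at the coordinate where the row vector [v] has largest
    modulus. *)
Lemma normc_eigenvalue A (K : R) (z : C) : (forall i j, normc (A i j) <= K) ->
  eigenvalue A z -> normc z <= n.+1%:R * K.
Proof.
move=> AK /eigenvalueP [v Av vn0].
have [j vj] : exists j, forall i, normc (v 0 i) <= normc (v 0 j).
  pose j := [arg max_(j > 0) normc (v 0 j)]%O.
  by exists j; rewrite /j; case: Order.TotalTheory.arg_maxP => // i _ H k; apply: H.
have vj0 : 0 < normc (v 0 j).
  rewrite normc_gt0; apply: contraNneq vn0 => vj0; apply/eqP/rowP => i.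
  have := vj i; rewrite vj0 normc0 mxE => vi.
  by apply/eqP; rewrite -normc_eq0 eq_le vi normc_ge0.
rewrite -(ler_pM2r vj0) -normcM.
have -> : z * v 0 j = \sum_k v 0 k * A k j.
  by have /rowP /(_ j) := Av; rewrite !mxE => <-.
apply: le_trans (normc_sum _ _ _) _.
apply: (@le_trans _ _ (\sum_(k < n.+1) K * normc (v 0 j))).
  by apply: ler_sum => k _; rewrite normcM mulrC ler_pM ?normc_ge0.
by rewrite sumr_const card_ord -mulrnAl mulr_natl.
Qed.

(** If every eigenvalue of [B] were at distance at least [e] from [z], then [det (z - B)], the
    product of these differences, would have modulus at least [e ^+ n.+1]. But [det (z - A) = 0] and
    the determinant is Lipschitz on bounded sets. The tolerance [d] depends on the bound [K]
    alone. *)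
Lemma spectral_variation (K e : R) : 0 < e -> exists2 d : R, 0 < d &
  forall A B (z : C), (forall i j, normc (A i j) <= K) ->
    (forall i j, normc (A i j - B i j) < d) -> eigenvalue A z ->
  exists2 w, eigenvalue B w & normc (z - w) < e.
Proof.
(* An eigenvalue of [A] has modulus at most [n.+1%:R * |K|], and the entries of [B] are at most
   [|K| + 1] because [d <= 1]; so [K'] bounds the entries of [z - A] and [z - B]. *)
move=> e0; pose K' : R := n.+1%:R * `|K| + `|K| + 1.
have K'1 : 1 <= K'.
  have := mulr_ge0 (ler0n R n.+1) (normr_ge0 K); have := normr_ge0 K.
  rewrite /K'; lra.
have [c c0 Hc] := det_lipschitz n K'1.
have en : 0 < e ^+ n.+1 by apply: exprn_gt0.
pose d := Num.min 1 (e ^+ n.+1 / (2 * c)).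
have d0 : 0 < d by rewrite lt_min ltr01 divr_gt0 // mulr_gt0.
have d1 : d <= 1 by rewrite ge_min lexx.
have cd : c * d < e ^+ n.+1.
  apply: (@le_lt_trans _ _ (c * (e ^+ n.+1 / (2 * c)))).
    by rewrite ler_pM2l // ge_min lexx orbT.
  have -> : c * (e ^+ n.+1 / (2 * c)) = e ^+ n.+1 / 2 by field; rewrite gt_eqF.
  lra.
exists d => // A B z AK ABd zA.
have zK : normc z <= n.+1%:R * `|K|.
  by apply: normc_eigenvalue zA => i j; apply: le_trans (AK i j) (ler_norm K).
have BK i j : normc (B i j) <= `|K| + 1.
  have -> : B i j = A i j - (A i j - B i j) by ring.
  apply: le_trans (normc_triangle _ _) _; rewrite normc_opp.
  have := ABd i j; have := AK i j; have := ler_norm K; lra.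
have shift (X : M) i j : normc (X i j) <= `|K| + 1 -> normc ((z%:M - X : M) i j) <= K'.
  move=> Xk; rewrite !mxE; apply: le_trans (normc_triangle _ _) _.
  rewrite normc_opp.
  have : normc (z *+ (i == j)) <= normc z.
    by case: (i == j); rewrite ?mulr1n ?mulr0n ?normc0 ?normc_ge0.
  rewrite /K'; lra.
have small : normc (\det (z%:M - B)) < e ^+ n.+1.
  have detA : \det (z%:M - A) = 0.
    by rewrite -horner_char_poly; apply/rootP; rewrite -eigenvalue_root_char.
  rewrite -[\det _]subr0 -detA normc_distC; apply: le_lt_trans cd.
  apply: Hc => i j; [apply: shift | apply: shift |].
  - by have := AK i j; have := ler_norm K; lra.
  - exact: BK.
  - rewrite !mxE; have -> : z *+ (i == j) - A i j - (z *+ (i == j) - B i j) =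
      B i j - A i j by ring.
    by rewrite normc_distC ltW.
have [/hasP [w wB zw]|/hasPn far] := boolP (has (fun w => normc (z - w) < e) (spectrum B)).
  by exists w; [rewrite -mem_spectrum | ].
suff : e ^+ n.+1 <= normc (\det (z%:M - B)) by rewrite leNgt small.
rewrite -horner_char_poly char_poly_spectrum -(size_spectrum B).
elim: (spectrum B) far => [|w s IH] far; first by rewrite big_nil hornerC normc1.
rewrite big_cons hornerM normcM /= exprS hornerXsubC ler_pM ?(ltW e0) ?exprn_ge0 ?(ltW e0) //.
  by rewrite leNgt; apply: far; rewrite mem_head.
by apply: IH => x xs; apply: far; rewrite inE xs orbT.
Qed.

(** [spectral_variation] is used in both directions; [K + 1] bounds the entries of both matrices. *)
Lemma specrad_continuous A (e : R) : 0 < e -> exists2 d : R, 0 < d &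
  forall B, (forall i j, normc (A i j - B i j) < d) ->
  `|specrad A - specrad B| < e.
Proof.
move=> e0; pose K := \big[Num.max/0]_i \big[Num.max/0]_j normc (A i j).
have AK i j : normc (A i j) <= K.
  apply: le_trans (le_bigmax _ (fun i => \big[Num.max/0]_j normc (A i j)) i).
  exact: (le_bigmax _ (fun j => normc (A i j)) j).
have [d d0 Hd] := spectral_variation (K + 1) e0.
exists (Num.min d 1); first by rewrite lt_min d0 ltr01.
move=> B ABd.
have ABd1 i j : normc (A i j - B i j) < d.
  by apply: lt_le_trans (ABd i j) _; rewrite ge_min lexx.
have ABd2 i j : normc (A i j - B i j) < 1.
  by apply: lt_le_trans (ABd i j) _; rewrite ge_min lexx orbT.
have AK1 i j : normc (A i j) <= K + 1 by have := AK i j; lra.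
have BK i j : normc (B i j) <= K + 1.
  have -> : B i j = A i j - (A i j - B i j) by ring.
  apply: le_trans (normc_triangle _ _) _; rewrite normc_opp.
  have := ABd2 i j; have := AK i j; lra.
have half (X Y : M) : (forall i j, normc (X i j) <= K + 1) ->
    (forall i j, normc (X i j - Y i j) < d) -> specrad X < specrad Y + e.
  move=> XK XY; have [z zX <-] := specrad_attained X.
  have [w /specrad_ub wY zw] := Hd _ _ _ XK XY zX.
  have -> : z = w + (z - w) by ring.
  by apply: le_lt_trans (normc_triangle _ _) _; lra.
have h1 := half _ _ AK1 ABd1.
have h2 : specrad B < specrad A + e by apply: half => // i j; rewrite normc_distC.
move: (specrad A) (specrad B) h1 h2 => a b h1 h2.
rewrite ltr_norml; apply/andP; split; lra.
Qed.

Lemma normcD_sqr (z w : C) : normc (z + w) ^+ 2 =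
  normc z ^+ 2 + normc w ^+ 2 + 2 * (Re z * Re w + Im z * Im w).
Proof. rewrite !sqr_normcE; case: z w => [a b] [a' b'] /=; ring. Qed.

(* Along the parabola [c0 + x + i x^2] the equidistance condition is a nonzero
   polynomial in [x] for every [mu <> lam]. *)
Lemma equidistant_mem (s : seq C) (lam c0 : C) (e : R) : 0 < e ->
    (forall c, normc (c - c0) < e ->
       exists2 mu, mu \in s & normc (c + mu) = normc (c + lam)) ->
  lam \in s.
Proof.
move=> e0 H; apply/negPn/negP => lams.
(* The [c] with [c + mu] and [c + lam] of equal modulus form a line. A segment could lie inside it,
   but an arc of a parabola cannot; the coefficients of degrees 2 and 1 vanish together only when
   [mu = lam]. *)
pose p (mu : C) : {poly R} := (2 * (Im mu - Im lam))%:P * 'X ^+ 2 +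
  (2 * (Re mu - Re lam))%:P * 'X + (normc (c0 + mu) ^+ 2 - normc (c0 + lam) ^+ 2)%:P.
have pE mu x : (p mu).[x] = normc (c0 + (x +i* x ^+ 2) + mu) ^+ 2
                            - normc (c0 + (x +i* x ^+ 2) + lam) ^+ 2.
  rewrite /p !hornerE /= !sqr_normcE; case: c0 mu lam {H lams p} => [a b] [a1 b1] [a2 b2] /=.
  ring.
have p0 mu : mu \in s -> p mu != 0.
  move=> mus; apply: contraNneq lams => pm0.
  have c2 : 2 * (Im mu - Im lam) = 0.
    by have /polyP /(_ 2%N) := pm0; rewrite /p !(coefD, coefCM, coefX, coefXn, coefC) /= mulr1 mulr0 !addr0.
  have c1 : 2 * (Re mu - Re lam) = 0.
    by have /polyP /(_ 1%N) := pm0; rewrite /p !(coefD, coefCM, coefX, coefXn, coefC) /= mulr1 mulr0 addr0 add0r.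
  suff -> : lam = mu by [].
  apply/eqP; rewrite eq_complex; apply/andP; split; apply/eqP; lra.
pose q := \prod_(mu <- s) p mu.
have q0 : q != 0 by rewrite /q prodf_seq_neq0; apply/allP => mu /p0.
pose d := Num.min 1 (e / 2).
have d0 : 0 < d by rewrite lt_min ltr01 divr_gt0.
have d1 : d <= 1 by rewrite ge_min lexx.
have d2 : d <= e / 2 by rewrite ge_min lexx orbT.
pose x k : R := d / k.+2%:R.
have k0 k : 0 < k.+2%:R :> R by apply: ltr0n.
have xpos k : 0 < x k by rewrite divr_gt0.
have xd k : 2 * x k <= d.
  by rewrite /x mulrA ler_pdivrMr // [2 * d]mulrC ler_pM2l // ler_nat.
have qx k : root q (x k).
  apply/rootP.
  have [mu mus Hmu] : exists2 mu, mu \in s &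
      normc (c0 + (x k +i* x k ^+ 2) + mu) = normc (c0 + (x k +i* x k ^+ 2) + lam).
    apply: H; have -> : c0 + (x k +i* x k ^+ 2) - c0 = (x k)%:C + (0 +i* x k ^+ 2).
      by rewrite addrC addKr; simpc.
    apply: le_lt_trans (normc_triangle _ _) _.
    rewrite /= expr0n /= addr0 add0r !sqrtr_sqr !gtr0_norm ?exprn_gt0 //.
    have := xpos k; have := xd k; nra.
  have pm : (p mu).[x k] = 0 by rewrite pE Hmu subrr.
  by rewrite /q horner_prod (big_rem mu mus) /= pm mul0r.
(* The [size q] distinct numbers [d / (k + 2)] are all roots of [q], one more than its degree
   allows. *)
have := @max_poly_roots _ q [seq x k | k <- iota 0 (size q)] q0.
rewrite size_map size_iota ltnn => H'; suff : false by [].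
apply: H'; first by apply/allP => y /mapP [k _ ->].
rewrite map_inj_uniq ?iota_uniq // => k l; rewrite /x => /(mulfI (lt0r_neq0 d0)).
by move=> /invr_inj /eqP; rewrite eqr_nat => /eqP [].
Qed.

(** The rational parametrization of the unit circle, by stereographic projection from -1. It yields
    as many distinct points as desired using field operations only. *)
Definition circle_point (k : nat) : C :=
  ((1 - k%:R ^+ 2) / (1 + k%:R ^+ 2)) +i* (2 * k%:R / (1 + k%:R ^+ 2)).

Lemma circle_point_denom (k : nat) : 0 < 1 + k%:R ^+ 2 :> R.
Proof. by have := sqr_ge0 (k%:R : R); lra. Qed.

Lemma normc_circle_point k : normc (circle_point k) = 1.
Proof.
have := circle_point_denom k; set x : R := k%:R => x0.
have e : ((1 - x ^+ 2) / (1 + x ^+ 2)) ^+ 2 + (2 * x / (1 + x ^+ 2)) ^+ 2 = 1.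
  by field; rewrite gt_eqF.
by rewrite /circle_point /= e sqrtr1.
Qed.

Local Arguments normc : simpl never.

(** The real part alone is injective on nonnegative parameters, as it determines the square of the
    parameter. *)
Lemma circle_point_inj : injective circle_point.
Proof.
move=> k l [e _]; apply/eqP; rewrite -(eqr_nat R).
move: e (circle_point_denom k) (circle_point_denom l).
have := ler0n R k; have := ler0n R l.
set x : R := k%:R; set y : R := l%:R => y0 x0 e xk yl.
have : (1 - x ^+ 2) * (1 + y ^+ 2) = (1 - y ^+ 2) * (1 + x ^+ 2).
  by apply/eqP; rewrite -eqr_div; [rewrite e | rewrite gt_eqF | rewrite gt_eqF].
move=> e2; have : x ^+ 2 = y ^+ 2 by lra.
by move=> e3; rewrite -(eqrXn2 (n := 2)) // e3.
Qed.

(** The parallelogram law: the squared moduli of [z + w] and [z - w] add up to 4. *)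
Lemma normcD_unit_lt (z w : C) : normc z = 1 -> normc w = 1 -> z != w ->
  normc (z + w) < 2.
Proof.
move=> z1 w1 zw; have : 0 < normc (z - w) by rewrite normc_gt0 subr_eq0.
have := normcD_sqr z w; have := normcD_sqr z (- w).
rewrite normc_opp z1 w1; case: w {w1 zw} => a b /=; set u := normc _; set v := normc _.
have : 0 <= u by apply: normc_ge0.
have : 0 <= v by apply: normc_ge0.
move=> v0 u0 e1 e2 up; rewrite ltNge; apply/negP => v2.
have : 4 <= v ^+ 2 by nra.
have : 0 < u ^+ 2 by apply: exprn_gt0.
lra.
Qed.

Lemma perm_of_uniq_sub (T : eqType) (s t : seq T) : uniq s ->
  {subset s <= t} -> (size t <= size s)%N -> perm_eq s t.
Proof.
move=> us st ts; have [_ eqst] := uniq_min_size us st ts.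
by apply: uniq_perm => //; apply: leq_size_uniq us st ts.
Qed.

(* Near [D] the spectrum lies near distinct points [z_j] of the unit circle, and
   for [c] near [z_j] the eigenvalue near [z_j] alone attains [specrad (c + A)]. *)
Lemma specrad_shifts_determine_traces : exists D : M,
  (forall i j, normc (D i j) <= 1) /\
  exists2 eta : R, 0 < eta &
  forall A B, (forall i j, normc (A i j - D i j) < eta) ->
    (forall c, normc c < 2 -> specrad (c%:M + B) = specrad (c%:M + A)) ->
  \tr (B *m B) = \tr (A *m A) /\ \tr (B *m B *m B) = \tr (A *m A *m A).
Proof.
pose z (j : 'I_n.+1) := circle_point j.
have z1 j : normc (z j) = 1 by apply: normc_circle_point.
have zI : injective z by move=> i j /circle_point_inj /val_inj.
pose D : M := diag_mx (\row_j z j).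
have D1 i j : normc (D i j) <= 1.
  by rewrite !mxE; case: (i == j); rewrite ?mulr1n ?mulr0n ?z1 ?normc0 ?ler01.
exists D; split=> //.
pose f (p : 'I_n.+1 * 'I_n.+1) := if p.1 == p.2 then 1 else
  Num.min (2 - normc (z p.1 + z p.2)) (normc (z p.1 - z p.2)).
have [e0 e00 He0] : exists2 e, 0 < e & forall p, e <= f p.
  apply: pos_family_lb => -[i j]; rewrite /f /=; case: eqP => // /eqP ij.
  have zij : z i != z j by apply: contraNneq ij => /zI ->.
  rewrite lt_min; apply/andP; split; last by rewrite normc_gt0 subr_eq0.
  by rewrite subr_gt0; apply: normcD_unit_lt.
(* For [c] within [e] of [z j], the modulus of [c + lam j] is at least [2 - 2 * e], while for
   [i != j] that of [c + lam i] is at most [(2 - 5 * e) + 2 * e]. A separation of [5 * e] between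
   the [z j] also keeps the [lam j] distinct. *)
pose e := e0 / 5.
have e_gt0 : 0 < e by rewrite divr_gt0.
have e_small : e <= 1 / 5.
  by have := He0 (0, 0); rewrite /f eqxx /e; lra.
have sep i j : i != j -> normc (z i + z j) <= 2 - 5 * e /\ 5 * e <= normc (z i - z j).
  move=> ij; have := He0 (i, j); rewrite /f /= (negPf ij) le_min => /andP [].
  by rewrite /e; lra.
have [d d0 Hd] := spectral_variation 1 e_gt0.
exists d => // A B AD AB.
have [lam lamA lamz] : exists2 lam : 'I_n.+1 -> C,
    (forall j, eigenvalue A (lam j)) & (forall j, normc (z j - lam j) < e).
  apply: (@fin_all_exists2 _ (fun _ => C) (fun _ w => eigenvalue A w)
    (fun j w => normc (z j - w) < e)) => j.
  apply: (Hd D A (z j)) => //; first by move=> i k; rewrite normc_distC.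
  apply/eigenvalueP; exists (delta_mx 0 j).
    rewrite mul_mx_diag; apply/rowP => k; rewrite !mxE eqxx /=.
    by case: (k =P j) => [->|_]; rewrite ?mul1r ?mulr1 ?mul0r ?mulr0.
  by apply/eqP => /rowP /(_ j); rewrite !mxE !eqxx => /eqP; rewrite oner_eq0.
have lamI : injective lam.
  move=> i j eij; apply/eqP/negPn/negP => /sep [_].
  have -> : z i - z j = (z i - lam i) + (lam j - z j) by rewrite eij; ring.
  apply/negP; rewrite -ltNge; apply: le_lt_trans (normc_triangle _ _) _.
  rewrite [normc (lam j - _)]normc_distC; have := lamz i; have := lamz j; lra.
pose L := [seq lam j | j <- enum 'I_n.+1].
have uL : uniq L by rewrite map_inj_uniq ?enum_uniq.
have sL : size L = n.+1 by rewrite size_map size_enum_ord.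
have pA : perm_eq L (spectrum A).
  apply: perm_of_uniq_sub; rewrite ?sL ?size_spectrum //.
  by move=> x /mapP [j _ ->]; rewrite mem_spectrum.
have dominate j c : normc (c - z j) < e ->
    specrad (c%:M + A) = normc (c + lam j).
  move=> cz; apply: specrad_eqP => [|x].
    by exists (c + lam j) => //; apply: eigenvalueDscalar.
  rewrite -[x in eigenvalue _ x](subrKC c) eigenvalue_addscalar -mem_spectrum.
  rewrite -(perm_mem pA) => /mapP [i _ ei].
  have -> : x = c + lam i by rewrite -ei; ring.
  have [->//|ij] := eqVneq i j; have [zz _] := sep _ _ ij.
  have h1 : normc (c + lam i) <= 2 - 3 * e.
    have -> : c + lam i = (z i + z j) + ((c - z j) + (lam i - z i)) by ring.
    apply: le_trans (normc_triangle _ _) _.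
    have := normc_triangle (c - z j) (lam i - z i).
    rewrite [normc (lam i - _)]normc_distC; have := lamz i; lra.
  have h2 : 2 - 2 * e <= normc (c + lam j).
    have : normc (z j + z j) <= normc (c + lam j) + (normc (z j - c) + normc (z j - lam j)).
      have -> : z j + z j = (c + lam j) + ((z j - c) + (z j - lam j)) by ring.
      apply: le_trans (normc_triangle _ _) _; rewrite lerD2l; exact: normc_triangle.
    have -> : z j + z j = 2%:C * z j.
      by case: (z j) => a b; simpc; congr (_ +i* _); ring.
    rewrite normcM z1 normc_real [normc (z j - c)]normc_distC normr_nat.
    have := lamz j; lra.
  lra.
(* For each [c] near [z j], some eigenvalue of [B] realizes the modulus of [c + lam j]. Which one
   may depend on [c], and [equidistant_mem] shows that [lam j] itself must occur. Counting then
   leaves no room for other eigenvalues or multiplicities. *)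
have pB : perm_eq L (spectrum B).
  apply: perm_of_uniq_sub; rewrite ?sL ?size_spectrum //.
  move=> _ /mapP [j _ ->]; apply: (@equidistant_mem _ _ (z j) e) => // c cz.
  have c2 : normc c < 2.
    have -> : c = z j + (c - z j) by ring.
    by apply: le_lt_trans (normc_triangle _ _) _; rewrite z1; lra.
  have [x xB xE] := specrad_attained (c%:M + B).
  exists (x - c).
    by rewrite mem_spectrum -(eigenvalue_addscalar _ _ c) subrKC.
  by rewrite subrKC xE (AB c c2) (dominate j c cz).
have [_ A2 A3] := mxtrace_spectrum A; have [_ B2 B3] := mxtrace_spectrum B.
have pBA : perm_eq (spectrum B) (spectrum A) by rewrite -(permPl pB).
by rewrite A2 A3 B2 B3; split; apply: perm_big.
Qed.

End SpectralVariation.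

(** * Jordan automorphisms of matrix algebras *)

Section Traceless.
Variables (K : fieldType) (n : nat).
Local Notation M := 'M[K]_n.+1.

Lemma rank1_sqr0 (u : 'cV[K]_n.+1) (w : 'rV[K]_n.+1) : w *m u = 0 ->
  (u *m w) *m (u *m w) = 0.
Proof. by move=> wu; rewrite -mulmxA (mulmxA w) wu mul0mx mulmx0. Qed.

Lemma delta_sqr0 c (i j : 'I_n.+1) : i != j ->
  (c *: delta_mx i j : M) *m (c *: delta_mx i j) = 0.
Proof.
move=> ij; rewrite -scalemxAl -scalemxAr mul_delta_mx_0 ?scaler0 //.
by rewrite eq_sym.
Qed.

(** Every traceless matrix is a sum of matrices of square zero: multiples of off-diagonal units, and
    [E_ii - E_00 = (e_i + e_0)(e_i - e_0)^T + E_i0 - E_0i], whose first term is a rank one matrix of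
    square zero. *)
Lemma traceless_ind (P : M -> Prop) : (forall x y, P x -> P y -> P (x + y)) ->
  (forall x, x *m x = 0 -> P x) -> forall x, \tr x = 0 -> P x.
Proof.
move=> PD Psqr x tx.
have P0 : P 0 by apply: Psqr; rewrite mulmx0.
have Pdelta c i j : i != j -> P (c *: delta_mx i j).
  by move=> ij; apply: Psqr; apply: delta_sqr0.
have Pdiag c i : P (c *: (delta_mx i i - delta_mx 0 0)).
  have [->|i0] := eqVneq i 0; first by rewrite subrr scaler0.
  pose u : 'cV[K]_n.+1 := delta_mx i 0 + delta_mx 0 0.
  pose w : 'rV[K]_n.+1 := delta_mx 0 i - delta_mx 0 0.
  have wu : w *m u = 0.
    rewrite mulmxBl !mulmxDr !mul_delta_mx !mul_delta_mx_0 //; last by rewrite eq_sym.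
    by rewrite addr0 add0r subrr.
  have -> : c *: (delta_mx i i - delta_mx 0 0) = c *: (u *m w) +
      (c *: delta_mx i 0 + (- c) *: delta_mx 0 i) :> M.
    rewrite mulmxBr !mulmxDl !mul_delta_mx; apply/matrixP => k l; rewrite !mxE; ring.
  apply: (PD); last by apply: (PD); apply: Pdelta; rewrite // eq_sym.
  apply: Psqr; rewrite -scalemxAl -scalemxAr rank1_sqr0 // !scaler0 //.
have -> : x = \sum_i (x i i *: (delta_mx i i - delta_mx 0 0) +
                      \sum_(j | j != i) x i j *: delta_mx i j).
  rewrite {1}[x]matrix_sum_delta big_split /=.
  under [X in _ = X + _]eq_bigr do rewrite scalerBr.
  rewrite sumrB -scaler_suml.
  rewrite -[\sum_i x i i]/(\tr x) tx scale0r subr0 -big_split /=.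
  by apply: eq_bigr => i _; rewrite (bigD1 i).
apply: big_ind => // i _; apply: (PD); first exact: Pdiag.
by apply: big_ind => // j ji; apply: Pdelta; rewrite eq_sym.
Qed.

Lemma mxtrace_mul_delta (X : M) i j : \tr (X *m delta_mx j i) = X i j.
Proof.
rewrite /mxtrace (bigD1 i) //= big1 => [|k ki]; rewrite !mxE.
  rewrite addr0 (bigD1 j) //= big1 => [|l lj].
    by rewrite mxE !eqxx mulr1 addr0.
  by rewrite mxE (negPf lj) mulr0.
by rewrite big1 // => l _; rewrite mxE (negPf ki) andbF mulr0.
Qed.

(** By [traceless_ind], [X] is orthogonal to all traceless matrices for the trace form. Pairing with
    [E_ji] kills the off-diagonal entries, pairing with [E_ii - E_00] equates the diagonal ones. *)
Lemma scalar_of_orthogonal (X : M) : (forall N, N *m N = 0 -> \tr (X *m N) = 0) ->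
  X = (X 0 0)%:M.
Proof.
move=> XN; have Xt N : \tr N = 0 -> \tr (X *m N) = 0.
  move: N; apply: (@traceless_ind (fun N => \tr (X *m N) = 0)) => // x y.
  by rewrite mulmxDr mxtraceD => -> ->; rewrite addr0.
apply/matrixP => i j; rewrite mxE; have [<-|ij] := eqVneq i j.
  have := Xt (delta_mx i i - delta_mx 0 0).
  rewrite mulmxBr !raddfB /= !mxtrace_mul_delta.
  have tE k : \tr (delta_mx k k : M) = 1.
    by rewrite -[delta_mx k k]mul1mx mxtrace_mul_delta mxE eqxx.
  by rewrite !tE subrr => /(_ erefl) /eqP; rewrite subr_eq0 => /eqP.
rewrite mulr0n -mxtrace_mul_delta; apply: XN.
by rewrite mul_delta_mx_0 //.
Qed.

End Traceless.

Section Jordan.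
Variables (K : fieldType) (n : nat).
Hypothesis two_neq0 : 2%:R != 0 :> K.
Local Notation M := 'M[K]_n.+1.
Local Notation E i j := (delta_mx i j : M).
Implicit Types J : {linear 'M[K]_n.+1 -> 'M[K]_n.+1}.

Definition jordan J := forall x, J x *m J x = J (x *m x).

Lemma jordan_anticomm J : jordan J ->
  forall x y, J x *m J y + J y *m J x = J (x *m y + y *m x).
Proof.
move=> hJ x y; have := hJ (x + y).
rewrite linearD !mulmxDl !mulmxDr !linearD /= !hJ => /eqP.
by rewrite -!addrA (can_eq (addKr _)) !addrA (can_eq (addrK _)) => /eqP ->.
Qed.

(** The images of the [E i i] are nonzero idempotents [P i]. From [P i P j + P j P i = 0],
    multiplied by [P i] on either side, they commute, hence [2 P i P j = 0]. Row vectors fixed by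
    the respective [P i] then form a basis that diagonalizes all of them. *)
Lemma jordan_fix_diag J : injective J -> jordan J ->
  exists2 V, V \in unitmx & forall i, V *m J (E i i) *m invmx V = E i i.
Proof.
move=> iJ hJ; pose P i := J (E i i).
have PP i : P i *m P i = P i by rewrite hJ mul_delta_mx.
have Pij i j : i != j -> P i *m P j = 0.
  move=> ij; have a : P i *m P j + P j *m P i = 0.
    rewrite jordan_anticomm // !mul_delta_mx_0 // ?addr0 ?linear0 //.
    by rewrite eq_sym.
  have c : P i *m P j = P j *m P i.
    have : P i *m (P i *m P j + P j *m P i) = (P i *m P j + P j *m P i) *m P i.
      by rewrite a mulmx0 mul0mx.
    rewrite mulmxDr mulmxDl !mulmxA PP -[X in _ = _ + X]mulmxA PP.
    by rewrite addrC => /addrI.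
  move: a; rewrite -c -mulr2n -scaler_nat => /eqP.
  by rewrite scaler_eq0 (negPf two_neq0) => /eqP.
have [v vP v0] : exists2 v : 'I_n.+1 -> 'rV[K]_n.+1,
    forall i, v i *m P i = v i & forall i, v i != 0.
  apply: (@fin_all_exists2 _ (fun _ => 'rV[K]_n.+1) (fun i w => w *m P i = w)
     (fun i w => w != 0)) => i.
  have : P i != 0.
    apply/eqP => Pi0; have : J (E i i) = J 0 by rewrite linear0.
    move=> /iJ /matrixP /(_ i i) /eqP; rewrite !mxE !eqxx oner_eq0 //.
  move=> /rowV0Pn [w /submxP [y ->] w0]; exists (y *m P i) => //.
  by rewrite -mulmxA PP.
pose V : M := \matrix_(i < n.+1) v i.
have VP j : V *m P j = E j j *m V.
  apply/row_matrixP => i; rewrite !row_mul rowK.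
  have [->|ij] := eqVneq i j.
    by rewrite vP rowE mul_delta_mx -rowE rowK.
  by rewrite -vP -mulmxA Pij // mulmx0 rowE mul_delta_mx_0 // mul0mx.
have Vu : V \in unitmx.
  rewrite -row_free_unit; apply/inj_row_free => w wV.
  apply/rowP => j; rewrite mxE.
  have : w *m V *m P j = 0 by rewrite wV mul0mx.
  rewrite -mulmxA VP mulmxA.
  have -> : w *m E j j = w 0 j *: delta_mx 0 j.
    apply/rowP => k; rewrite !mxE (bigD1 j) //= big1 => [|l lj].
      by rewrite !mxE !eqxx /= addr0 eq_sym.
    by rewrite mxE (negPf lj) mulr0.
  rewrite -scalemxAl -rowE rowK => /eqP.
  by rewrite scaler_eq0 (negPf (v0 j)) orbF => /eqP.
by exists V => // i; rewrite VP mulmxK.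
Qed.

Section FixDiag.
Variable J : {linear 'M[K]_n.+1 -> 'M[K]_n.+1}.
Hypotheses (hJ : jordan J) (fixJ : forall i, J (E i i) = E i i).

Lemma mul_delta_diagE (X : M) i k l :
  (E i i *m X) k l = (k == i)%:R * X k l /\ (X *m E i i) k l = (l == i)%:R * X k l.
Proof.
split; rewrite mxE (bigD1 i) //= big1 => [|m mi].
- by rewrite mxE eqxx andbT addr0; case: eqP => [->|_]; rewrite ?mul0r.
- by rewrite mxE (negPf mi) andbF mul0r.
- by rewrite mxE eqxx /= addr0 mulrC; case: eqP => [->|_]; rewrite ?mul0r.
by rewrite mxE (negPf mi) mulr0.
Qed.

(** The image [X] of [E i j] satisfies [E i i X + X E i i = X], and the same with [j]. At an entry
    whose two indices are both [i] or both different from [i], this reads [2 x = x] or [0 = x]. Only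
    the positions (i, j) and (j, i) survive both tests. *)
Lemma jordan_unit_supp i j k l : i != j -> ~~ ((k == i) && (l == j)) ->
  ~~ ((k == j) && (l == i)) -> J (E i j) k l = 0.
Proof.
move=> ij kl1 kl2; set X := J _.
have e1 : E i i *m X + X *m E i i = X.
  rewrite -[E i i]fixJ /X jordan_anticomm // mul_delta_mx mul_delta_mx_0 ?addr0 //.
  by rewrite eq_sym.
have e2 : E j j *m X + X *m E j j = X.
  rewrite -[E j j]fixJ /X jordan_anticomm // mul_delta_mx mul_delta_mx_0 ?add0r //.
  by rewrite eq_sym.
have f m : E m m *m X + X *m E m m = X -> (k == m) = (l == m) -> X k l = 0.
  move=> /matrixP /(_ k l) + klm; rewrite mxE.
  have [-> ->] := mul_delta_diagE X m k l; rewrite klm.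
  case: (l == m); rewrite ?mul1r ?mul0r ?addr0 // => /eqP.
  by rewrite -subr_eq0 addrK => /eqP.
have f1 := f _ e1; have f2 := f _ e2.
have [ki|/negPf ki] := eqVneq k i; have [li|/negPf li] := eqVneq l i.
- by apply: f1; rewrite ki li.
- apply: f2; rewrite ki (negPf ij); move: kl1.
  by rewrite ki eqxx /= => /negPf ->.
- apply: f2; rewrite li (negPf ij); move: kl2.
  by rewrite li eqxx andbT => /negPf ->.
- by apply: f1; rewrite ki li.
Qed.

(** Let a_ij and b_ij be the coefficients of [J (E i j)] on [E i j] and [E j i]. The Jordan product
    of [E i j] and [E j k] is [E i k], so each of the two families is multiplicative along i, j,
    k. *)
Lemma jordan_coef_chain i j k : i != j -> j != k -> i != k ->
  J (E i k) i k = J (E i j) i j * J (E j k) j k /\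
  J (E i k) k i = J (E i j) j i * J (E j k) k j.
Proof.
move=> ij jk ik.
have e : J (E i j) *m J (E j k) + J (E j k) *m J (E i j) = J (E i k).
  by rewrite jordan_anticomm // mul_delta_mx mul_delta_mx_0 ?addr0 // eq_sym.
have ji : j != i by rewrite eq_sym.
have ki : k != i by rewrite eq_sym.
have kj : k != j by rewrite eq_sym.
split; rewrite -e mxE ![in LHS]mxE (bigD1 j) //= [X in _ + X + _]big1 ?addr0
  => [|m mj].
- rewrite [X in _ + X]big1 ?addr0 // => m _.
  by rewrite jordan_unit_supp ?mul0r // ?(negPf ij) ?(negPf ik).
- by rewrite jordan_unit_supp ?mul0r // ?(negPf mj) ?andbF ?(negPf ij).
- rewrite jordan_unit_supp ?(negPf ki) ?(negPf kj) // mul0r add0r.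
  rewrite (bigD1 j) //= big1 ?addr0 1?mulrC // => m mj.
  by rewrite jordan_unit_supp ?mul0r // ?(negPf mj) ?(negPf kj) ?andbF.
by rewrite jordan_unit_supp ?mul0r // ?(negPf ki) ?(negPf kj).
Qed.

Lemma jordan_coef_inv i j : i != j ->
  J (E i j) i j * J (E j i) j i + J (E i j) j i * J (E j i) i j = 1.
Proof.
move=> ij; have ji : j != i by rewrite eq_sym.
have e : J (E i j) *m J (E j i) + J (E j i) *m J (E i j) = E i i + E j j.
  by rewrite jordan_anticomm // !mul_delta_mx linearD /= !fixJ.
have /matrixP /(_ i i) := e; rewrite !mxE !eqxx (negPf ij) /= mulr1n mulr0n addr0 => <-.
congr (_ + _); rewrite (bigD1 j) //= big1 => [|m mj].
- by rewrite addr0.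
- by rewrite jordan_unit_supp ?mul0r // ?(negPf mj) ?andbF ?(negPf ij).
- by rewrite addr0 mulrC.
- by rewrite jordan_unit_supp ?mul0r // ?(negPf mj) ?andbF ?(negPf ij).
Qed.

Lemma jordan_coef_mul0 i j : i != j -> J (E i j) i j * J (E i j) j i = 0.
Proof.
move=> ij; have := hJ (E i j); rewrite mul_delta_mx_0 1?eq_sym // linear0.
move=> /matrixP /(_ i i); rewrite !mxE (bigD1 j) //= big1 ?addr0 // => m mj.
by rewrite jordan_unit_supp ?mul0r // ?(negPf mj) ?andbF ?(negPf ij).
Qed.

(** Without b the coefficients form a cocycle, a_ik = a_ij a_jk, hence a coboundary: a_ij = a_i0
    a_0j, which is conjugation by the diagonal matrix of the a_i0. *)
Lemma jordan_straight : (forall i j, i != j -> J (E i j) j i = 0) ->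
  exists2 u, u \in unitmx & forall x, J x = u *m x *m invmx u.
Proof.
move=> b0; pose a i j := J (E i j) i j.
have aii i : a i i = 1 by rewrite /a fixJ mxE !eqxx.
have JE i j : J (E i j) = a i j *: E i j.
  have [<-|ij] := eqVneq i j; first by rewrite aii scale1r fixJ.
  apply/matrixP => k l; rewrite !mxE.
  have [/andP [/eqP -> /eqP ->]|kl] := boolP ((k == i) && (l == j)).
    by rewrite mulr1.
  have [/andP [/eqP -> /eqP ->]|lk] := boolP ((k == j) && (l == i)).
    by rewrite b0 // mulr0.
  by rewrite mulr0 jordan_unit_supp.
have aV i j : a i j * a j i = 1.
  have [->|ij] := eqVneq i j; first by rewrite !aii mulr1.
  by have := jordan_coef_inv ij; rewrite b0 // mul0r addr0.
have aM i j k : a i k = a i j * a j k.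
  have [<-|ij] := eqVneq i j; first by rewrite aii mul1r.
  have [<-|jk] := eqVneq j k; first by rewrite aii mulr1.
  have [<-|ik] := eqVneq i k; first by rewrite aii aV.
  by have [] := jordan_coef_chain ij jk ik.
pose u : M := diag_mx (\row_i a i 0); pose w : M := diag_mx (\row_i a 0 i).
have uw : u *m w = 1%:M.
  rewrite mulmx_diag; apply/matrixP => i j; rewrite !mxE.
  by rewrite aV.
have Uu : u \in unitmx by apply: (mulmx1_unit uw).1.
have wE : invmx u = w.
  by rewrite -[LHS]mulmx1 -uw mulmxA mulVmx // mul1mx.
exists u => // x; rewrite wE {1}[x]matrix_sum_delta linear_sum /=.
apply/matrixP => i j; rewrite mul_mx_diag mul_diag_mx !mxE.
rewrite summxE (bigD1 i) //= [X in _ + X]big1 => [|k ki]; last first.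
  rewrite linear_sum summxE big1 // => l _.
  by rewrite linearZ /= JE !mxE eq_sym (negPf ki) !mulr0.
rewrite addr0 linear_sum summxE (bigD1 j) //= [X in _ + X]big1 => [|l lj].
  by rewrite addr0 linearZ /= JE !mxE !eqxx mulr1 (aM i 0) mulrCA mulrA.
by rewrite linearZ /= JE !mxE [j == l]eq_sym (negPf lj) andbF !mulr0.
Qed.

End FixDiag.

Lemma jordan_form J : injective J -> jordan J ->
  exists2 u, u \in unitmx & (forall x, J x = u *m x *m invmx u) \/
    (forall x, J x = u *m x^T *m invmx u).
Proof.
move=> iJ hJ; have [V Vu VJ] := jordan_fix_diag iJ hJ.
pose J1 : {linear 'M[K]_n.+1 -> 'M[K]_n.+1} := mulmx V \o mulmxr (invmx V) \o J.
have J1E x : J1 x = V *m J x *m invmx V by rewrite /J1 /= mulmxA.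
have hJ1 : jordan J1 by move=> x; rewrite !J1E -hJ !mulmxA mulmxKV.
have fJ1 i : J1 (E i i) = E i i by rewrite J1E VJ.
have JE x : J x = invmx V *m J1 x *m V by rewrite J1E !mulmxA mulVmx // mul1mx mulmxKV.
have iJ1 : injective J1 by move=> x y exy; apply: iJ; rewrite !JE exy.
pose J2 : {linear 'M[K]_n.+1 -> 'M[K]_n.+1} := @trmx K _ _ \o J1.
have J2E x : J2 x = (J1 x)^T by [].
have hJ2 : jordan J2 by move=> x; rewrite !J2E -trmx_mul hJ1.
have fJ2 i : J2 (E i i) = E i i by rewrite J2E fJ1 trmx_delta.
have conclude (u : M) : u \in unitmx -> invmx V *m u \in unitmx /\
    forall y, invmx V *m (u *m y *m invmx u) *m V =
      (invmx V *m u) *m y *m invmx (invmx V *m u).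
  move=> uu; have Vu' : invmx V *m u \in unitmx by rewrite unitmx_mul unitmx_inv Vu.
  split=> // y; apply: (canRL (mulmxK Vu')).
  by rewrite !mulmxA mulmxK // mulmxKV.
have nz i j : i != j -> J1 (E i j) i j != 0 \/ J1 (E i j) j i != 0.
  move=> ij; have := jordan_coef_inv hJ1 fJ1 ij.
  have [->|] := eqVneq (J1 (E i j) i j) 0; last by left.
  have [->|] := eqVneq (J1 (E i j) j i) 0; last by right.
  by rewrite !mul0r addr0 => /eqP; rewrite eq_sym oner_eq0.
(* One nonzero a_ij forces b_ij = 0; the vanishing of b spreads along rows by the chain rule and to
   the opposite position by [flip], so it reaches every pair. If instead all a vanish, transposition
   exchanges the two families and [J2] is straight. *)
have [/existsP [i /existsP [j /andP [ij aij]]]|] :=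
  boolP [exists i, exists j, (i != j) && (J1 (E i j) i j != 0)].
- have str k l : k != l -> J1 (E k l) k l != 0 -> J1 (E k l) l k = 0.
    move=> kl akl; have /eqP := jordan_coef_mul0 hJ1 fJ1 kl.
    by rewrite mulf_eq0 (negPf akl) => /eqP.
  have ts k l : k != l -> J1 (E k l) l k = 0 -> J1 (E k l) k l != 0.
    by move=> kl bkl; case: (nz _ _ kl); rewrite // bkl eqxx.
  have rowS k l m : k != l -> k != m -> J1 (E k l) l k = 0 -> J1 (E k m) m k = 0.
    move=> kl km bkl; have [<-//|lm] := eqVneq l m.
    by have [_ ->] := jordan_coef_chain hJ1 fJ1 kl lm km; rewrite bkl mul0r.
  have flip k l : k != l -> J1 (E k l) l k = 0 -> J1 (E l k) k l = 0.
    move=> kl bkl; apply: str; first by rewrite eq_sym.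
    have := jordan_coef_inv hJ1 fJ1 kl; rewrite bkl mul0r addr0.
    by apply: contra_eqN => /eqP ->; rewrite mulr0 eq_sym oner_eq0.
  have [|u uu Hu] := jordan_straight hJ1 fJ1.
    move=> k l kl; have bij := str _ _ ij aij.
    have [ki|ki] := eqVneq k i.
      by move: kl; rewrite ki => il; apply: rowS ij il bij.
    have ik : i != k by rewrite eq_sym.
    by apply: rowS kl (flip _ _ ik (rowS _ _ _ ij ik bij)).
  have [uV uE] := conclude u uu.
  by exists (invmx V *m u) => //; left=> x; rewrite JE Hu uE.
- rewrite negb_exists => /forallP H.
  have [|u uu Hu] := jordan_straight hJ2 fJ2.
    move=> k l kl; rewrite J2E mxE; have := H k; rewrite negb_exists.
    by move=> /forallP /(_ l); rewrite kl negbK => /eqP.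
  pose t := (invmx u)^T; have tu : t \in unitmx by rewrite unitmx_tr unitmx_inv.
  have tV : invmx t = u^T by rewrite /t trmx_inv invmxK.
  have [uV uE] := conclude t tu.
  exists (invmx V *m t) => //; right=> x; rewrite JE -uE; congr (_ *m _ *m _).
  have <- : (J2 x)^T = J1 x by rewrite J2E trmxK.
  by rewrite Hu !trmx_mul tV /t mulmxA.
Qed.

End Jordan.

(** * Polarization of the traces of squares and cubes *)

Section TraceForms.
Variables (K : fieldType) (n : nat).
Local Notation M := 'M[K]_n.+1.

Definition trace2 (x : M) := \tr (x *m x).
Definition trace3 (x : M) := \tr (x *m x *m x).

Lemma trace2_polar (a h k : M) :
  trace2 (a + h + k) - trace2 (a + h) - trace2 (a + k) + trace2 a =
  2 * \tr (h *m k).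
Proof.
rewrite /trace2 !(mulmxDl, mulmxDr, mxtraceD).
rewrite (mxtrace_mulC h a) (mxtrace_mulC k a) (mxtrace_mulC k h); ring.
Qed.

Lemma trace2_sub (x y : M) : trace2 (x - y) = trace2 x - 2 * \tr (x *m y) + trace2 y.
Proof.
rewrite /trace2 !(mulmxDl, mulmxDr, mulmxN, mulNmx, opprK) !raddfD /= !raddfN /=.
rewrite (mxtrace_mulC y x); ring.
Qed.

(** The third difference of a cubic form in the directions h, h, k. The six orderings of these
    factors have the same trace by cyclicity, whence the 6. *)
Lemma trace3_polar (a h k : M) :
  trace3 (a + h + h + k) - 2 * trace3 (a + h + k) + trace3 (a + k) -
  (trace3 (a + h + h) - 2 * trace3 (a + h) + trace3 a) =
  6 * \tr (h *m h *m k).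
Proof.
have c (x y z : M) : \tr (x *m y *m z) = \tr (z *m x *m y).
  by rewrite mxtrace_mulC mulmxA.
rewrite /trace3 !(mulmxDl, mulmxDr, mxtraceD).
rewrite (c h a a) (c a h a) (c k a a) (c a k a) (c h a h) (c h h a) (c k a k).
rewrite (c k k a) (c k h h) (c h k h) (c k h k) (c k k h) (c k a h) (c h k a).
rewrite (c h a k) (c k h a); ring.
Qed.

End TraceForms.

Lemma linear_inj_surj (K : fieldType) n (G : {linear 'M[K]_n -> 'M[K]_n}) :
  injective G -> forall y, exists x, G x = y.
Proof.
move=> iG y; have Gu : lin_mx G \in unitmx.
  rewrite -row_free_unit; apply/inj_row_free => w wG.
  have : G (vec_mx w) = G 0.
    by apply: (can_inj mxvecK); rewrite -mul_vec_lin vec_mxK wG linear0 linear0.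
  by move=> /iG w0; rewrite -[w]vec_mxK w0 linear0.
exists (vec_mx (mxvec y *m invmx (lin_mx G))).
by apply: (can_inj mxvecK); rewrite -mul_vec_lin vec_mxK mulmxKV.
Qed.

(** [Phi] is not assumed linear. Pairing with the values of [Psi] is a linear map [T] that recovers
    [h] from [Phi h]. The values of [Phi] at scaled matrix units provide a one-sided inverse [A] of
    the square matrix [T], hence its inverse, and so [Phi] coincides with [A] on [P]. The scalings
    [s] and [s'] serve maps controlled only near 0. *)
Lemma linear_of_trace_dual (K : fieldType) n (P : 'M[K]_n.+1 -> Prop)
    (Phi Psi : 'M[K]_n.+1 -> 'M[K]_n.+1) (s s' : K) : s != 0 -> s' != 0 ->
    (forall i j, P (s *: delta_mx i j)) ->
    (forall h i j, P h -> \tr (Phi h *m Psi (s' *: delta_mx i j)) =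
                          \tr (h *m (s' *: delta_mx i j))) ->
  exists L : {linear 'M[K]_n.+1 -> 'M[K]_n.+1}, forall h, P h -> Phi h = L h.
Proof.
move=> s0 s'0 Ps tP.
pose b (k : 'I_(n.+1 * n.+1)) : 'M[K]_n.+1 := vec_mx (delta_mx 0 k).
have bE k : exists i j, b k = delta_mx i j /\ forall X : 'M[K]_n.+1, mxvec X 0 k = X i j.
  by case/mxvec_indexP: k => i j; exists i, j; rewrite /b vec_mx_delta; split=> // X; rewrite mxvecE.
pose psi k := Psi (s' *: (b k)^T).
have dual h k : P h -> \tr (Phi h *m psi k) = s' * mxvec h 0 k.
  move=> Ph; have [i [j [bk Xk]]] := bE k.
  by rewrite /psi bk trmx_delta tP // -scalemxAr linearZ /= mxtrace_mul_delta Xk.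
pose A := \matrix_k (s^-1 *: mxvec (Phi (s *: b k))).
pose T := \matrix_(i, k) (s'^-1 * \tr (b i *m psi k)).
have TE Y : mxvec Y *m T = \row_k (s'^-1 * \tr (Y *m psi k)).
  apply/rowP => k; rewrite !mxE.
  have -> : \tr (Y *m psi k) = \sum_i mxvec Y 0 i * \tr (b i *m psi k).
    have {1}-> : Y = \sum_i mxvec Y 0 i *: b i.
      rewrite -[Y in LHS]mxvecK [mxvec Y in LHS]row_sum_delta linear_sum.
      by apply: eq_bigr => i _; rewrite linearZ.
    rewrite mulmx_suml linear_sum; apply: eq_bigr => i _.
    by rewrite -scalemxAl linearZ.
  by rewrite mulr_sumr; apply: eq_bigr => i _; rewrite mxE mulrCA.
have TP h : P h -> mxvec (Phi h) *m T = mxvec h.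
  by move=> Ph; rewrite TE; apply/rowP => k; rewrite mxE dual // mulKf.
have AT : A *m T = 1%:M.
  apply/row_matrixP => k; rewrite row_mul rowK -scalemxAl TP; last first.
    by have [i [j [-> _]]] := bE k; apply: Ps.
  rewrite /b linearZ /= vec_mxK scalerA mulVf // scale1r.
  by rewrite rowE mulmx1.
exists (vec_mx \o mulmxr A \o mxvec) => h Ph; rewrite /=.
by rewrite -[mxvec h]TP // -mulmxA (mulmx1C AT) mulmx1 mxvecK.
Qed.

(** * Maps preserving the spectral radius *)

Section SpecradMaps.
Variables (R : rcfType) (n : nat).
Local Notation C := R[i].
Local Notation M := 'M[C]_n.+1.

Definition mxnear (r : R) (x y : M) := forall i j, normc (x i j - y i j) < r.

Lemma mxnear_refl r x : 0 < r -> mxnear r x x.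
Proof. by move=> r0 i j; rewrite subrr normc0. Qed.

Lemma mxnear_trans r s x y z : mxnear r x y -> mxnear s y z -> mxnear (r + s) x z.
Proof.
move=> xy yz i j; have -> : x i j - z i j = (x i j - y i j) + (y i j - z i j) by ring.
by apply: le_lt_trans (normc_triangle _ _) _; apply: ltrD.
Qed.

Lemma mxnear_le r s x y : r <= s -> mxnear r x y -> mxnear s x y.
Proof. by move=> rs xy i j; apply: lt_le_trans (xy i j) rs. Qed.

Lemma realc_neq0 (s : R) : s != 0 -> s%:C != 0 :> C.
Proof. by move=> s0; rewrite -normc_eq0 normc_real normr_eq0. Qed.

Lemma natc_neq0 k : k.+1%:R != 0 :> C.
Proof. by rewrite pnatr_eq0. Qed.

Lemma mxentries_bounded (h : M) :
  exists2 K : R, 0 < K & forall i j, normc (h i j) <= K.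
Proof.
pose K := \big[Num.max/0]_i \big[Num.max/0]_j normc (h i j).
have hK i j : normc (h i j) <= K.
  apply: le_trans (le_bigmax _ (fun i => \big[Num.max/0]_j normc (h i j)) i).
  exact: (le_bigmax _ (fun j => normc (h i j)) j).
have K0 : 0 <= K by apply: le_trans (normc_ge0 _) (hK 0 0).
exists (K + 1) => [|i j]; [lra | have := hK i j; lra].
Qed.

Lemma small_multiple (h : M) (e : R) : 0 < e -> exists2 s0 : R, 0 < s0 &
  forall s, 0 < s -> s <= s0 -> forall i j, normc ((s%:C *: h) i j) < e.
Proof.
move=> e0; have [K K0 hK] := mxentries_bounded h.
exists (e / (2 * K)); first by rewrite divr_gt0 ?mulr_gt0.
move=> s s0; rewrite ler_pdivlMr ?mulr_gt0 // => se i j.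
rewrite mxE normcM normc_real gtr0_norm //.
have : s * normc (h i j) <= s * K by rewrite ler_pM2l.
have := mulr_gt0 s0 K0; lra.
Qed.

Lemma specrad_linear_form (G : {linear 'M[C]_n.+1 -> 'M[C]_n.+1}) :
    (forall c h, specrad (c%:M + G h) = specrad (c%:M + h)) ->
  exists2 u, u \in unitmx & (forall x, G x = u *m x *m invmx u) \/
    (forall x, G x = u *m x^T *m invmx u).
Proof.
move=> HG; have [D [_ [eta eta0 HD]]] := specrad_shifts_determine_traces R n.
have near A : mxnear eta A D -> trace2 (G A) = trace2 A /\ trace3 (G A) = trace3 A.
  by move=> AD; apply: HD => // c _; apply: HG.
(* The farthest point used, [D + h + h + k], is three small increments away from [D]. *)
have e4 : 0 < eta / 4 by rewrite divr_gt0.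
pose small (h : M) := forall i j, normc (h i j) < eta / 4.
have addnear (r s : R) x h : s = r + eta / 4 -> mxnear r x D -> small h ->
    mxnear s (x + h) D.
  move=> -> xD hs i j; rewrite mxE.
  have -> : x i j + h i j - D i j = (x i j - D i j) + h i j by ring.
  by apply: le_lt_trans (normc_triangle _ _) _; apply: ltrD.
have D0 : mxnear (eta / 4) D D by apply: mxnear_refl.
have rescale (f : M -> Prop) : (forall h, small h -> f h) ->
    (forall h (s : C), s != 0 -> f (s *: h) -> f h) -> forall h, f h.
  move=> fs fZ h; have [s s0 hs] := small_multiple h e4.
  by apply: (fZ h s%:C); [apply: realc_neq0; rewrite gt_eqF | apply/fs/hs].
have G2 h k : \tr (G h *m G k) = \tr (h *m k).
  move: h; apply: (rescale) => [h hs|h s s0]; last first.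
    rewrite linearZ /= -!scalemxAl !mxtraceZ; exact: mulfI.
  move: k; apply: (rescale) => [k ks|k s s0]; last first.
    rewrite linearZ /= -!scalemxAr !mxtraceZ; exact: mulfI.
  apply: (mulfI (natc_neq0 1)).
  rewrite -(trace2_polar D h k) -(trace2_polar (G D) (G h) (G k)) -!linearD.
  have Dh : mxnear (eta / 2) (D + h) D by apply: (addnear (eta / 4)) => //; lra.
  have Dk : mxnear (eta / 2) (D + k) D by apply: (addnear (eta / 4)) => //; lra.
  have Dhk : mxnear (eta / 2 + eta / 4) (D + h + k) D by apply: addnear (erefl _) Dh ks.
  have [|-> _] := near (D + h + k); first by apply: mxnear_le Dhk; lra.
  have [|-> _] := near (D + h); first by apply: mxnear_le Dh; lra.
  have [|-> _] := near (D + k); first by apply: mxnear_le Dk; lra.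
  by have [|-> _] := near D; first by apply: mxnear_refl.
have G3 h k : \tr (G h *m G h *m G k) = \tr (h *m h *m k).
  move: h; apply: (rescale) => [h hs|h s s0]; last first.
    rewrite linearZ /= -!scalemxAl -!scalemxAr -!scalemxAl !mxtraceZ.
    by move=> /(mulfI s0) /(mulfI s0).
  move: k; apply: (rescale) => [k ks|k s s0]; last first.
    rewrite linearZ /= -!scalemxAr !mxtraceZ; exact: mulfI.
  apply: (mulfI (natc_neq0 5)).
  rewrite -(trace3_polar D h k) -(trace3_polar (G D) (G h) (G k)) -!linearD.
  have Dh : mxnear (eta / 2) (D + h) D by apply: (addnear (eta / 4)) => //; lra.
  have Dk : mxnear (eta / 2) (D + k) D by apply: (addnear (eta / 4)) => //; lra.
  have Dhk : mxnear (eta / 2 + eta / 4) (D + h + k) D by apply: addnear (erefl _) Dh ks.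
  have Dhh : mxnear (eta / 2 + eta / 4) (D + h + h) D by apply: addnear (erefl _) Dh hs.
  have Dhhk : mxnear eta (D + h + h + k) D by apply: (addnear _ _ _ _ _ Dhh ks); lra.
  have [_ ->] := near (D + h + h + k) Dhhk.
  have [|_ ->] := near (D + h + k); first by apply: mxnear_le Dhk; lra.
  have [|_ ->] := near (D + h + h); first by apply: mxnear_le Dhh; lra.
  have [|_ ->] := near (D + h); first by apply: mxnear_le Dh; lra.
  have [|_ ->] := near (D + k); first by apply: mxnear_le Dk; lra.
  by have [|_ ->] := near D; first by apply: mxnear_refl.
have sep (x : M) : (forall k, \tr (x *m k) = 0) -> x = 0.
  by move=> H; apply/matrixP => i j; rewrite -mxtrace_mul_delta H mxE.
have iG : injective G.
  move=> x y exy; apply/eqP; rewrite -subr_eq0; apply/eqP/sep => k.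
  by rewrite -G2 linearB /= exy subrr mul0mx linear0.
apply: (@jordan_form _ _ (natc_neq0 1) G iG) => x.
apply/eqP; rewrite -subr_eq0; apply/eqP/sep => k.
(* As [G] is onto, pairing with the values [G k'] is enough: both [(G x) ^ 2] and [G (x ^ 2)] give
   [tr (x ^ 2 k')]. *)
have [k' <-] := linear_inj_surj iG k.
by rewrite mulmxBl linearB /= G3 G2 subrr.
Qed.

(** For [x] near [x0] and [y] near [y0 = x0 - t D], the quotient [(x - y) / t] is near [D], so [G]
    preserves the trace of the square of [x - y]. Since [x] and [y] vary independently, polarization
    gives the pairing of increments at [x0] with increments at [y0], as [linear_of_trace_dual]
    requires. *)
Lemma specrad_local_linear (G : M -> M) (x0 : M) (r : R) : 0 < r ->
    (forall x y c, mxnear r x x0 -> mxnear r y x0 -> normc c < r ->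
       specrad (c%:M + (G x - G y)) = specrad (c%:M + (x - y))) ->
  exists2 d : R, 0 < d & exists L : {linear 'M[C]_n.+1 -> 'M[C]_n.+1},
    forall x, mxnear d x x0 -> G x - G x0 = L (x - x0).
Proof.
move=> r0 HG; have [D [D1 [eta' eta'0 HD]]] := specrad_shifts_determine_traces R n.
pose eta := Num.min 1 eta'.
have eta0 : 0 < eta by rewrite lt_min ltr01.
have eta1 : eta <= 1 by rewrite ge_min lexx.
have eta_le : eta <= eta' by rewrite ge_min lexx orbT.
(* With [t = r / 8], both neighbourhoods and the shifts [t c] with [c] of modulus below 2 stay
   within [r]. The choice of [d] makes two errors below [d], divided by [t], add up to less than
   [eta]. *)
pose t := r / 8; have t0 : 0 < t by rewrite divr_gt0.
have tC : t%:C != 0 :> C by apply: realc_neq0; rewrite gt_eqF.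
pose d := t * eta / 2; have d0 : 0 < d by apply: divr_gt0 => //; apply: mulr_gt0.
have dt : d <= t / 2 by rewrite /d; nra.
pose y0 : M := x0 - t%:C *: D.
have quad x y : mxnear d x x0 -> mxnear d y y0 -> trace2 (G x - G y) = trace2 (x - y).
  move=> xx yy.
  have yx : mxnear r y x0.
    have y0x : mxnear (2 * t) y0 x0.
      move=> i j; rewrite !mxE.
      have -> : x0 i j - t%:C * D i j - x0 i j = - (t%:C * D i j) by ring.
      rewrite normc_opp normcM normc_real gtr0_norm //.
      have := D1 i j; have := normc_ge0 (D i j); nra.
    apply: mxnear_le (mxnear_trans yy y0x); rewrite /t in dt t0 *; lra.
  have xx' : mxnear r x x0 by apply: mxnear_le xx; rewrite /t in dt t0 *; lra.
  have unscale (X : M) : trace2 X = t%:C ^+ 2 * trace2 (t%:C^-1 *: X).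
    rewrite /trace2 -scalemxAl -scalemxAr !mxtraceZ expr2.
    by field.
  suff e : trace2 (t%:C^-1 *: (G x - G y)) = trace2 (t%:C^-1 *: (x - y)).
    by rewrite (unscale (G x - G y)) e -unscale.
  apply: (proj1 (HD (t%:C^-1 *: (x - y)) (t%:C^-1 *: (G x - G y)) _ _)) => [i j|c c2].
    apply: lt_le_trans eta_le; rewrite !mxE.
    have -> : t%:C^-1 * (x i j - y i j) - D i j =
      t%:C^-1 * ((x i j - x0 i j) - (y i j - y0 i j)).
      by rewrite !mxE; field.
    rewrite normcM normcV normc_real gtr0_norm // mulrC ltr_pdivrMr //.
    apply: le_lt_trans (normc_triangle _ _) _; rewrite normc_opp.
    have := xx i j; have := yy i j; rewrite /d; lra.
  have cE (X : M) : c%:M + t%:C^-1 *: X = t%:C^-1 *: ((t%:C * c)%:M + X).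
    by rewrite scalerDr scale_scalar_mx mulKf.
  rewrite !cE !specradZ HG // normcM normc_real gtr0_norm //.
  rewrite /t in t0 *; have := normc_ge0 c; nra.
have polar x y : mxnear d x x0 -> mxnear d y y0 ->
    \tr ((G x - G x0) *m (G y - G y0)) = \tr ((x - x0) *m (y - y0)).
  move=> xx yy; have xx0 := mxnear_refl x0 d0; have yy0 := mxnear_refl y0 d0.
  apply: (mulfI (natc_neq0 1)).
  have four (a b c e : M) : 2 * \tr ((a - b) *m (c - e)) =
      trace2 (a - e) + trace2 (b - c) - trace2 (a - c) - trace2 (b - e).
    rewrite !trace2_sub mulmxBl !mulmxBr !raddfB /=; ring.
  by rewrite !four !quad.
pose s := d / 2; have s0 : 0 < s by rewrite divr_gt0.
have sC : s%:C != 0 :> C by apply: realc_neq0; rewrite gt_eqF.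
have deltaN (z : M) i j : mxnear d (z + s%:C *: delta_mx i j) z.
  move=> k l; rewrite !mxE.
  have -> : z k l + s%:C * ((k == i) && (l == j))%:R - z k l =
     s%:C * ((k == i) && (l == j))%:R by ring.
  rewrite normcM normc_real gtr0_norm //; case: (_ && _); rewrite ?normc0 ?mulr0 //.
  by rewrite normc1 mulr1 /s; lra.
have [||L HL] := @linear_of_trace_dual _ n (fun h => mxnear d (x0 + h) x0)
    (fun h => G (x0 + h) - G x0) (fun k => G (y0 + k) - G y0) _ _ sC sC.
- by move=> i j; apply: deltaN.
- move=> h i j Ph; rewrite (polar _ _ Ph (deltaN y0 i j)).
  by rewrite ![_ + _ - _]addrC !addKr.
exists d => //; exists L => x xx.
by have := HL (x - x0); rewrite subrKC => ->.
Qed.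

(** * Real linear maps preserving the spectral radius *)

Section RealLinear.
Variable L : M -> M.
Implicit Types x y : M.
Hypotheses (LD : forall x y : M, L (x + y) = L x + L y)
  (LZ : forall (t : R) (x : M), L (t%:C *: x) = t%:C *: L x)
  (Lrho : forall x, specrad (L x) = specrad x).

Lemma mxtrace_nil x : specrad x = 0 -> \tr x = 0.
Proof.
move=> x0; apply/eqP; rewrite -normc_eq0 eq_le normc_ge0 andbT.
by have := normc_mxtrace x; rewrite x0 mulr0.
Qed.

Lemma trace2_nil x : specrad x = 0 -> trace2 x = 0.
Proof.
move=> x0; apply/eqP; rewrite -normc_eq0 eq_le normc_ge0 andbT.
by have := normc_mxtrace_sqr x; rewrite x0 expr0n mulr0.
Qed.

Lemma trace2D (x y : M) : trace2 (x + y) = trace2 x + 2 * \tr (x *m y) + trace2 y.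
Proof.
rewrite /trace2 !(mulmxDl, mulmxDr, mxtraceD) (mxtrace_mulC y x); ring.
Qed.

Lemma real_linear_traceless x : \tr x = 0 -> \tr (L x) = 0.
Proof.
apply: (@traceless_ind _ _ (fun x => \tr (L x) = 0)) => {x} [x y|x xx].
  by rewrite LD mxtraceD => -> ->; rewrite addr0.
by apply: mxtrace_nil; rewrite Lrho; apply: specrad_sqr0.
Qed.

(** Adding [x] to [N] does not change the image, hence not the spectral radius. For [N] of square
    zero, the traces of the squares of [x], [N] and [x + N] all vanish, so [tr (x N) = 0]; thus [x]
    is scalar, and its spectral radius is 0. *)
Lemma real_linear_ker x : L x = 0 -> x = 0.
Proof.
move=> Lx0; have sx : specrad x = 0 by rewrite -Lrho Lx0 specrad0.
have scal : x = (x 0 0)%:M.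
  apply: scalar_of_orthogonal => N NN.
  have sN : specrad (x + N) = 0 by rewrite -Lrho LD Lx0 add0r Lrho specrad_sqr0.
  have := trace2D x N; rewrite (trace2_nil sx) (trace2_nil sN).
  rewrite (trace2_nil (specrad_sqr0 NN)) add0r addr0 => /esym/eqP; rewrite mulf_eq0 (negPf (natc_neq0 1)).
  by move/eqP.
have : normc (x 0 0) = 0 by rewrite -(specrad_scalar n) -scal.
by move=> /eq0_normc x00; rewrite scal x00 raddf0.
Qed.

(** [L] is not complex linear, so dimensions are counted over the reals, on pairs of real and
    imaginary parts. *)
Lemma real_linear_surj y : exists x, L x = y.
Proof.
pose V := ('M[R]_n.+1 * 'M[R]_n.+1)%type.
pose ofV (v : V) : M := \matrix_(i, j) (v.1 i j +i* v.2 i j).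
pose toV (x : M) : V := (\matrix_(i, j) Re (x i j), \matrix_(i, j) Im (x i j)).
have toVK : cancel toV ofV.
  by move=> x; apply/matrixP => i j; rewrite !mxE; case: (x i j).
have ofVK : cancel ofV toV.
  by move=> [a b]; congr (_, _); apply/matrixP => i j; rewrite !mxE.
have ofVlin (t : R) (u v : V) : ofV (t *: u + v) = t%:C *: ofV u + ofV v.
  apply/matrixP => i j; rewrite !mxE; simpc; congr (_ +i* _); ring.
have toVlin (t : R) (u v : M) : toV (t%:C *: u + v) = t *: toV u + toV v.
  by apply: (can_inj ofVK); rewrite ofVlin !toVK.
pose f (v : V) := toV (L (ofV v)).
have flin : linear f by move=> t u v; rewrite /f ofVlin LD LZ toVlin.
pose g : {linear V -> V} := HB.pack f (GRing.isLinear.Build R V V *:%R f flin).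
have k0 : lker (linfun g) == 0%VS.
  apply/lker0P => u v; rewrite !lfunE /= /f => /(can_inj toVK) e.
  apply: (can_inj ofVK); apply/eqP; rewrite -subr_eq0; apply/eqP/real_linear_ker.
  by rewrite -scaleN1r -[-1](rmorphN1 (real_complex R)) LD LZ e rmorphN1 scaleN1r subrr.
exists (ofV ((linfun g)^-1%VF (toV y))); apply: (can_inj toVK).
by rewrite -[LHS]/(g _) -lfunE lker0_lfunVK.
Qed.

Lemma bounded_affine (a b : C) (K : R) :
  (forall t : R, normc (a + t%:C * b) <= K) -> b = 0.
Proof.
move=> H; apply/eqP/negPn/negP => b0; have bp : 0 < normc b by rewrite normc_gt0.
pose t := (K + normc a + 1) / normc b.
have K0 : 0 <= K by apply: le_trans (normc_ge0 _) (H 0).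
have tb : normc (t%:C * b) = K + normc a + 1.
  rewrite normcM normc_real ger0_norm /t ?divfK ?gt_eqF //.
  by rewrite divr_ge0 ?(ltW bp) //; have := normc_ge0 a; lra.
have := normc_triangle (a + t%:C * b) (- a).
have -> : a + t%:C * b - a = t%:C * b by ring.
have := H t; rewrite normc_opp tb; lra.
Qed.

(** Write [N] of square zero as [L N']; then [N'] has spectral radius 0, and [c + t N'] has spectral
    radius [|c|] for every real [t]. Hence [tr ((L c + t N) ^ 2)] is bounded in [t]. It is affine in
    [t] with slope [2 tr (L c N)], which must therefore vanish. *)
Lemma real_linear_scalar c : exists g, L c%:M = g%:M.
Proof.
exists (L c%:M 0 0); apply: scalar_of_orthogonal => N NN.
have [N' eN] := real_linear_surj N.
have sN' : specrad N' = 0 by rewrite -Lrho eN; apply: specrad_sqr0.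
have tN : trace2 N = 0 by apply: trace2_nil; apply: specrad_sqr0.
apply/eqP; suff : 2 * \tr (L c%:M *m N) = 0.
  by move=> /eqP; rewrite mulf_eq0 (negPf (natc_neq0 1)).
apply: (@bounded_affine (trace2 (L c%:M)) _ (n.+1%:R * normc c ^+ 2)) => t.
have := normc_mxtrace_sqr (L (c%:M + t%:C *: N')).
rewrite Lrho specrad_addscalar_nil ?specradZ ?sN' ?mulr0 //.
rewrite -/(trace2 _) LD LZ eN trace2D -scalemxAr mxtraceZ.
have -> : trace2 (t%:C *: N) = 0.
  by rewrite /trace2 -scalemxAl -scalemxAr !mxtraceZ -/(trace2 N) tN !mulr0.
by rewrite addr0 mulrCA.
Qed.

End RealLinear.

End SpecradMaps.

(** * Isometries of a planar disc *)

Section PlanarIsometry.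
Variable R : rcfType.
Local Notation C := R[i].

(** After division by [g] the map fixes 0 and a real point [s] of the disc. It preserves inner
    products, so those with [s] and with the image of [i s], which is [i s] or [- i s], give both
    coordinates. *)
Lemma planar_isometry (phi : C -> C) (r : R) : 0 < r -> phi 0 = 0 ->
    (forall c c', normc c < r -> normc c' < r ->
       normc (phi c - phi c') = normc (c - c')) ->
  exists2 g, normc g = 1 &
    (forall c, normc c < r -> phi c = g * c) \/
    (forall c, normc c < r -> phi c = g * conjc c).
Proof.
move=> r0 phi0 H; pose s := r / 2; have s0 : 0 < s by rewrite divr_gt0.
have sr : s < r by rewrite /s; lra.
have sC : s%:C != 0 :> C by apply: realc_neq0; rewrite gt_eqF.
have r00 : normc (0 : C) < r by rewrite normc0.
have ns : normc (s%:C : C) < r by rewrite normc_real gtr0_norm.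
pose g := phi s%:C / s%:C.
have g1 : normc g = 1.
  have := H _ _ ns r00; rewrite phi0 !subr0 /g normcM normcV => ->.
  by rewrite divff // normc_eq0.
have g0 : g != 0 by rewrite -normc_gt0 g1.
pose psi c := phi c / g.
have phiE c : phi c = g * psi c by rewrite /psi mulrC divfK.
have psis : psi s%:C = s%:C.
  by apply: (mulfI g0); rewrite -phiE /g divfK.
have Hpsi c c' : normc c < r -> normc c' < r -> normc (psi c - psi c') = normc (c - c').
  by move=> cr cr'; rewrite -H // /psi -mulrBl normcM normcV g1 invr1 mulr1.
have psi0 : psi 0 = 0 by rewrite /psi phi0 mul0r.
have npsi c : normc c < r -> normc (psi c) = normc c.
  by move=> cr; have := Hpsi _ _ cr r00; rewrite psi0 !subr0.
have dot c c' : normc c < r -> normc c' < r ->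
    Re (psi c) * Re (psi c') + Im (psi c) * Im (psi c') = Re c * Re c' + Im c * Im c'.
  move=> cr cr'; have := congr1 (fun x => x ^+ 2) (Hpsi _ _ cr cr').
  have := congr1 (fun x => x ^+ 2) (npsi _ cr).
  have := congr1 (fun x => x ^+ 2) (npsi _ cr').
  rewrite /= !normcD_sqr !normc_opp.
  have ReN (z : C) : Re (- z) = - Re z by case: z.
  have ImN (z : C) : Im (- z) = - Im z by case: z.
  rewrite !ReN !ImN; lra.
have Repsi c : normc c < r -> Re (psi c) = Re c.
  move=> cr; have := dot _ _ cr ns; rewrite psis /= !mulr0 !addr0.
  by move=> /mulIf -> //; rewrite gt_eqF.
pose si : C := 0 +i* s.
have nsi : normc si < r.
  by rewrite /si /normc expr0n add0r sqrtr_sqr gtr0_norm.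
have Resi := Repsi _ nsi; have Imdot c (cr : normc c < r) := dot _ _ cr nsi.
have p : Im (psi si) = s \/ Im (psi si) = - s.
  have := Imdot _ nsi; rewrite Resi /= !mulr0 !add0r => e.
  have /eqP : (Im (psi si) - s) * (Im (psi si) + s) = 0 by rewrite -subr_sqr !expr2 e subrr.
  by rewrite mulf_eq0 subr_eq0 addr_eq0 => /orP [] /eqP; [left | right].
have cE (z w : C) : Re z = Re w -> Im z = Im w -> z = w.
  by case: z w => [a b] [a' b'] /= -> ->.
exists g => //; case: p => e; [left | right] => c cr; rewrite phiE; congr (_ * _);
  have := Imdot _ cr; rewrite Resi e /= !mulr0 !add0r => eb.
  by apply: cE; [apply: Repsi | apply: (mulIf (lt0r_neq0 s0))].
apply: cE; first by rewrite Repsi //; case: (c).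
have -> : Im (conjc c) = - Im c by case: (c).
by apply: (mulIf (lt0r_neq0 s0)); rewrite mulNr -eb mulrN opprK.
Qed.

End PlanarIsometry.

(** * Spectral radius isometries of a domain *)

Local Notation R := Rdefinitions.R.

Lemma zero_derivative_const (f : R -> R) :
  (forall t : R, 0 <= t <= 1 -> forall e : R, 0 < e -> exists2 d : R, 0 < d &
     forall s : R, `|s| < d -> `|f (t + s) - f t| <= e * `|s|) ->
  f 1 = f 0.
Proof.
move=> H; have dl c : (Rle 0 c /\ Rle c 1) -> derivable_pt_lim f c 0.
  move=> [/RleP c0 /RleP c1] e /RltP e0.
  have e2 : 0 < e / 2 by rewrite divr_gt0.
  have c01 : 0 <= c <= 1 by rewrite c0 c1.
  have [d d0 Hd] := H c c01 _ e2.
  have d0' : Rlt 0 d by apply/RltP.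
  exists (mkposreal d d0') => h /eqP h0 /RltP /=.
  rewrite RabsE => hd; apply/RltP; rewrite RabsE RdivE !RminusE RplusE subr0 normrM normfV.
  have hp : 0 < `|h| by rewrite normr_gt0.
  rewrite ltr_pdivrMr //; apply: le_lt_trans (Hd h hd) _.
  by rewrite ltr_pM2r //; lra.
have [c [e _]] := MVT_cor2 f (fun=> 0) 0 1 Rlt_0_1 dl.
by apply/eqP; rewrite -subr_eq0 -RminusE e Rmult_0_l.
Qed.

(** * Differentials and increments along scalar and traceless directions *)

Section LocalStructure.
Variable n : nat.
Local Notation C := R[i].
Local Notation M := 'M[C]_n.+1.

Definition mxopen (U : M -> Prop) :=
  forall x, U x -> exists2 e : R, 0 < e & forall y, mxnear e y x -> U y.

Definition real_linear (L : M -> M) :=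
  (forall x y : M, L (x + y) = L x + L y) /\
  (forall (t : R) (x : M), L (t%:C *: x) = t%:C *: L x).

(** Here [t] stands for the max norm of [h]: the estimate is asked for every bound of the
    entries. *)
Definition is_diff (U : M -> Prop) (F : M -> M) (x : M) (L : M -> M) :=
  real_linear L /\ forall e : R, 0 < e -> exists2 d : R, 0 < d &
    forall (h : M) (t : R), t < d -> (forall i j, normc (h i j) <= t) -> U (x + h) ->
    forall i j, normc ((F (x + h) - F x - L h) i j) <= e * t.

Lemma real_linear0 L : real_linear L -> L 0 = 0.
Proof. by move=> [_ LZ]; rewrite -[0 in LHS](scale0r (0 : M)) (LZ 0) scale0r. Qed.

Lemma real_linearN L x : real_linear L -> L (- x) = - L x.
Proof.
move=> rL; apply/eqP; rewrite -addr_eq0 -(proj1 rL) addNr.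
by rewrite real_linear0.
Qed.

Lemma real_linearB L x y : real_linear L -> L (x - y) = L x - L y.
Proof. by move=> rL; rewrite (proj1 rL) real_linearN. Qed.

Lemma near_add (r : R) (x h : M) : (forall i j, normc (h i j) < r) ->
  mxnear r (x + h) x.
Proof. by move=> hr i j; rewrite mxE addrAC subrr add0r. Qed.

Lemma diff_specrad U F x L : mxopen U -> U x -> is_diff U F x L ->
    (forall y, U y -> specrad (F y - F x) = specrad (y - x)) ->
  forall h, specrad (L h) = specrad h.
Proof.
move=> oU Ux [[LD LZ] dL] iso h; apply/eqP; rewrite -subr_eq0 -normr_eq0 eq_le.
(* The tolerance is the supposed gap between [specrad (L h)] and [specrad h]. A difference quotient
   [B] close to [L h] has spectral radius [specrad h], so the gap would be smaller than itself. *)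
rewrite normr_ge0 andbT leNgt; apply/negP => /(specrad_continuous (L h)) [d d0 Hd].
have [K K0 hK] := mxentries_bounded h.
have e0 : 0 < d / (2 * K) by rewrite divr_gt0 ?mulr_gt0.
have [d1 d10 H1] := dL _ e0; have [r r0 Hr] := oU _ Ux.
pose m := Num.min d1 r; have m0 : 0 < m by rewrite lt_min d10.
pose t := m / (2 * K); have t0 : 0 < t by rewrite divr_gt0 ?mulr_gt0.
have tK : t * K < m.
  have -> : t * K = m / 2 by rewrite /t; field; rewrite gt_eqF.
  lra.
have tC : t%:C != 0 :> C by apply: realc_neq0; rewrite gt_eqF.
have thK i j : normc ((t%:C *: h) i j) <= t * K.
  by rewrite mxE normcM normc_real gtr0_norm // ler_pM2l.
have Uth : U (x + t%:C *: h).
  apply/Hr/near_add => i j; apply: le_lt_trans (thK i j) _.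
  by apply: lt_le_trans tK _; rewrite ge_min lexx orbT.
have tKd : t * K < d1 by apply: lt_le_trans tK _; rewrite ge_min lexx.
pose B := t%:C^-1 *: (F (x + t%:C *: h) - F x).
have BL i j : normc (L h i j - B i j) < d.
  have -> : L h i j - B i j =
      - t%:C^-1 * (F (x + t%:C *: h) - F x - L (t%:C *: h)) i j.
    by rewrite LZ /B !mxE; field.
  rewrite normcM normc_opp normcV normc_real gtr0_norm // mulrC ltr_pdivrMr //.
  apply: le_lt_trans (H1 _ _ tKd thK Uth i j) _.
  have -> : d / (2 * K) * (t * K) = d * t / 2 by field; rewrite gt_eqF.
  have := mulr_gt0 d0 t0; lra.
have := Hd _ BL.
have -> : specrad B = specrad h.
  by rewrite /B specradZ iso // addrAC subrr add0r specradZ normcV mulKf // normc_eq0.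
by rewrite ltxx.
Qed.

Lemma mxtrace_mul_bound (W : M) : exists2 N : R, 0 < N &
  forall (X : M) (b : R), (forall i j, normc (X i j) <= b) ->
    normc (\tr (W *m X)) <= N * b.
Proof.
pose N := \sum_i \sum_j normc (W i j).
have N0 : 0 <= N by apply: sumr_ge0 => i _; apply: sumr_ge0 => j _; apply: normc_ge0.
exists (N + 1); first by lra.
move=> X b Xb; have b0 : 0 <= b by apply: le_trans (normc_ge0 _) (Xb 0 0).
have : normc (\tr (W *m X)) <= N * b; last by nra.
rewrite /N mulr_suml; apply: le_trans (normc_sum _ _ _) _.
apply: ler_sum => i _; rewrite mxE mulr_suml; apply: le_trans (normc_sum _ _ _) _.
by apply: ler_sum => j _; rewrite normcM ler_wpM2l ?normc_ge0.
Qed.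

(** The mean value theorem for the linear form [tr (W X)] of [F] along the segment, whose derivative
    vanishes. *)
Lemma segment_const U F (W p h : M) : mxopen U ->
    (forall t : R, 0 <= t <= 1 -> U (p + t%:C *: h)) ->
    (forall t : R, 0 <= t <= 1 -> exists2 L, is_diff U F (p + t%:C *: h) L &
       \tr (W *m L h) = 0) ->
  \tr (W *m (F (p + h) - F p)) = 0.
Proof.
move=> oU Uph Dph.
(* The mean value theorem is real: it is applied to the real parts of the forms given by [W] and by
   ['i *: W], whose kernels contain that of [W]. *)
suff ReW (W' : M) : (forall X, \tr (W *m X) = 0 -> \tr (W' *m X) = 0) ->
    Re (\tr (W' *m (F (p + h) - F p))) = 0.
  have h1 := ReW W (fun X e => e).
  have : Re (\tr (('i *: W) *m (F (p + h) - F p))) = 0.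
    by apply: ReW => X e; rewrite -scalemxAl mxtraceZ e mulr0.
  rewrite -scalemxAl mxtraceZ; move: h1; case: (\tr _) => a b /= -> /=.
  by rewrite mul0r sub0r mul1r => /eqP; rewrite oppr_eq0 => /eqP ->.
move=> WW'; pose f (t : R) := Re (\tr (W' *m F (p + t%:C *: h))).
have ReD (z w : C) : Re (z - w) = Re z - Re w by case: z w => [a b] [a' b'].
suff : f 1 = f 0.
  rewrite /f scale1r scale0r addr0 => e.
  by rewrite mulmxBr raddfB /= ReD e subrr.
have [N N0 HN] := mxtrace_mul_bound W'; have [K K0 hK] := mxentries_bounded h.
apply: zero_derivative_const => t t01 e e0.
have [L [[LD LZ] dL] /WW' tL] := Dph t t01.
have e0' : 0 < e / (N * K) by rewrite divr_gt0 ?mulr_gt0.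
have [d1 d10 H1] := dL _ e0'; have [r r0 Hr] := oU _ (Uph t t01).
exists (Num.min d1 r / K); first by rewrite divr_gt0 // lt_min d10.
move=> s; rewrite ltr_pdivlMr // lt_min => /andP [sd sr].
rewrite /f; pose q := p + t%:C *: h.
have -> : p + (t + s)%:C *: h = q + s%:C *: h by rewrite rmorphD scalerDl addrA.
have shK i j : normc ((s%:C *: h) i j) <= `|s| * K.
  by rewrite mxE normcM normc_real ler_wpM2l.
have Uqs : U (q + s%:C *: h).
  by apply/Hr/near_add => i j; apply: le_lt_trans (shK i j) sr.
have HX := H1 _ _ sd shK Uqs.
rewrite -/q -ReD -raddfB -mulmxBr /=.
have -> : \tr (W' *m (F (q + s%:C *: h) - F q)) =
    \tr (W' *m (F (q + s%:C *: h) - F q - L (s%:C *: h))).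
  rewrite LZ [in RHS]mulmxBr -scalemxAr [RHS](raddfB (@mxtrace _ _)) /=.
  by rewrite mxtraceZ tL mulr0 subr0.
apply: le_trans (normc_Re _) _; apply: le_trans (HN _ _ HX) _.
have -> : N * (e / (N * K) * (`|s| * K)) = e * `|s|; last by [].
by field; rewrite !gt_eqF.
Qed.

Lemma scalec_le (t : R) (z : C) : 0 <= t <= 1 -> normc (t%:C * z) <= normc z.
Proof.
move=> /andP [t0 t1]; rewrite normcM normc_real ger0_norm //.
by rewrite ler_piMl // normc_ge0.
Qed.

Definition conj_if (b : bool) (z : C) : C := if b then conjc z else z.

Lemma conj_ifD b z w : conj_if b (z + w) = conj_if b z + conj_if b w.
Proof. by case: b; rewrite //= rmorphD. Qed.

Lemma conj_ifM b z w : conj_if b (z * w) = conj_if b z * conj_if b w.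
Proof. by case: b; rewrite //= rmorphM. Qed.

Lemma conj_ifK b : involutive (conj_if b).
Proof. by case: b => z //=; rewrite conjcK. Qed.

Lemma conj_if_real b (t : R) : conj_if b t%:C = t%:C.
Proof. by case: b; [apply: conjc_real | ]. Qed.

Lemma normc_conj_if b z : normc (conj_if b z) = normc z.
Proof. by case: b; [apply: normc_conj | ]. Qed.

Lemma specrad_conj_if b (A : M) : specrad (map_mx (conj_if b) A) = specrad A.
Proof.
case: b; first exact: specrad_conj.
by congr specrad; apply/matrixP => i j; rewrite mxE.
Qed.

Section Isometry.
Variables (U : M -> Prop) (F : M -> M).
Hypotheses (oU : mxopen U) (dF : forall x, U x -> exists L, is_diff U F x L)
  (isoF : forall x y, U x -> U y -> specrad (F x - F y) = specrad (x - y)).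

Lemma diff_facts x : U x -> exists2 L, is_diff U F x L &
  (forall c, exists g, L c%:M = g%:M) /\ (forall N, \tr N = 0 -> \tr (L N) = 0).
Proof.
move=> Ux; have [L dL] := dF Ux; exists L => //.
have [[LD LZ] _] := dL.
have Lrho := diff_specrad oU Ux dL (fun y Uy => isoF Uy Ux).
by split=> [c|N]; [apply: real_linear_scalar | apply: real_linear_traceless].
Qed.

(** Derivatives send scalars to scalars, which are orthogonal to every [N] of square zero;
    integrated, the increment is orthogonal to all such [N]. *)
Lemma increment_scalar p c : (forall t : R, 0 <= t <= 1 -> U (p + t%:C *: c%:M)) ->
  exists s, F (p + c%:M) - F p = s%:M.
Proof.
move=> Up; exists ((F (p + c%:M) - F p) 0 0); apply: scalar_of_orthogonal => N NN.
rewrite mxtrace_mulC; apply: (segment_const oU Up) => t t01.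
have [L dL [Lc _]] := diff_facts (Up t t01); exists L => //.
have [g ->] := Lc c; rewrite mul_mx_scalar mxtraceZ mxtrace_nil ?mulr0 //.
exact: specrad_sqr0.
Qed.

Lemma mxtrace_traceless_const p N : \tr N = 0 ->
  (forall t : R, 0 <= t <= 1 -> U (p + t%:C *: N)) -> \tr (F (p + N)) = \tr (F p).
Proof.
move=> N0 Up; apply/eqP; rewrite -subr_eq0 -raddfB /= -[F _ - F _]mul1mx; apply/eqP.
apply: (segment_const oU Up) => t t01.
have [L dL [_ Lt]] := diff_facts (Up t t01); exists L => //.
by rewrite mul1mx Lt.
Qed.

Lemma local_scalar x0 : U x0 -> exists2 r : R, 0 < r & exists2 g : C, normc g = 1 &
  exists b, forall q c, mxnear r q x0 -> normc c < r ->
    [/\ U q, U (q + c%:M) & F (q + c%:M) = F q + (g * conj_if b c)%:M].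
Proof.
move=> Ux0; have [rho rho0 Hrho] := oU Ux0.
(* Points within [4 * r] of [x0], moved by less than [4 * r], remain in the ball of radius [rho]. *)
pose r := rho / 8; have r0 : 0 < r by rewrite divr_gt0.
have scal_small (c : C) (a : R) : normc c < a -> forall i j, normc ((c%:M : M) i j) < a.
  move=> ca i j; rewrite mxE; case: (i == j); rewrite ?mulr1n ?mulr0n ?normc0 //.
  exact: le_lt_trans (normc_ge0 _) ca.
have nearU (q h : M) (a : R) : a <= 4 * r -> mxnear (4 * r) q x0 ->
    (forall i j, normc (h i j) < a) ->
    forall t : R, 0 <= t <= 1 -> U (q + t%:C *: h).
  move=> ar qx ha t t01; apply: Hrho.
  have qh : mxnear a (q + t%:C *: h) q.
    by apply: near_add => i j; rewrite mxE; apply: le_lt_trans (scalec_le _ t01) _.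
  by apply: mxnear_le (mxnear_trans qh qx); rewrite /r in ar *; lra.
have atone (q h : M) : U (q + 1%:C *: h) -> U (q + h) by rewrite scale1r.
have incr (q : M) (c : C) : mxnear (4 * r) q x0 -> normc c < 4 * r ->
    U (q + c%:M) /\ exists s, F (q + c%:M) - F q = s%:M.
  move=> qx cr; have H := nearU q c%:M _ (lexx _) qx (scal_small _ _ cr).
  by split; [apply: atone; apply: H; rewrite ler01 lexx | apply: increment_scalar].
have x0x : mxnear (4 * r) x0 x0 by apply: mxnear_refl; rewrite mulr_gt0.
pose phi c := (F (x0 + c%:M) - F x0) 0 0.
have phiE c : normc c < 4 * r -> F (x0 + c%:M) = F x0 + (phi c)%:M.
  move=> cr; have [_ [s e]] := incr _ _ x0x cr.
  by rewrite /phi e mxE eqxx mulr1n -e subrKC.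
have [g g1 Hg] : exists2 g, normc g = 1 &
    (forall c, normc c < 4 * r -> phi c = g * c) \/
    (forall c, normc c < 4 * r -> phi c = g * conjc c).
  apply: planar_isometry; first by rewrite mulr_gt0.
    by rewrite /phi raddf0 addr0 subrr mxE.
  move=> c c' cr cr'; rewrite -!(specrad_scalar n) !raddfB /=.
  have [Uc _] := incr _ _ x0x cr; have [Uc' _] := incr _ _ x0x cr'.
  have := isoF Uc Uc'; rewrite (phiE c cr) (phiE c' cr').
  have cancel (y z w : M) : y + z - (y + w) = z - w by rewrite opprD addrACA subrr add0r.
  by rewrite !cancel.
have {Hg} [b Hb] : exists b, forall c, normc c < 4 * r -> phi c = g * conj_if b c.
  by case: Hg => Hg; [exists false | exists true].
exists r => //; exists g => //; exists b => q c qx cr.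
have cr4 : normc c < 4 * r by lra.
have qx4 : mxnear (4 * r) q x0 by apply: mxnear_le qx; lra.
have Uq : U q by apply: Hrho; apply: mxnear_le qx; rewrite /r; lra.
have [Uqc [s es]] := incr q c qx4 cr4; split=> //.
(* Since [q + c' = x0 + (d + c') + N] with [N] traceless, [tr (F (q + c'))] is read off from the
   scalar translates of [x0]. Subtracting the case [c' = 0] determines the increment at [q] by the
   same [g] and [b]. *)
pose d := (\tr (q - x0)) / n.+1%:R; pose N := q - x0 - d%:M.
have n0 : n.+1%:R != 0 :> C by apply: natc_neq0.
have N0 : \tr N = 0.
  have dn : d *+ n.+1 = \tr (q - x0) by rewrite -mulr_natr /d divfK.
  by rewrite /N (raddfB (@mxtrace _ _)) /= mxtrace_scalar dn subrr.
have dr : normc d < r.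
  rewrite /d normcM normcV.
  have -> : normc (n.+1%:R : C) = n.+1%:R.
    by rewrite -(rmorph_nat (real_complex R)) normc_real normr_nat.
  rewrite ltr_pdivrMr ?ltr0n //; apply: le_lt_trans (normc_sum _ _ _) _.
  rewrite mulr_natr -[X in _ *+ X](card_ord n.+1) -sumr_const.
  apply: ltr_sum => [|i _]; first by apply/hasP; exists 0; rewrite ?mem_index_enum.
  by rewrite !mxE.
have Nr i j : normc (N i j) < 2 * r.
  rewrite mxE; apply: le_lt_trans (normc_triangle _ _) _.
  have := qx i j; have := scal_small _ _ dr i j; rewrite !mxE normc_opp; lra.
have shift (c' : C) : normc c' < r -> \tr (F (q + c'%:M)) =
    \tr (F x0) + n.+1%:R * (g * conj_if b (d + c')).
  move=> cr'; have dc : normc (d + c') < 2 * r.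
    by apply: le_lt_trans (normc_triangle _ _) _; lra.
  have -> : q + c'%:M = (x0 + (d + c')%:M) + N.
    rewrite /N raddfD /=; apply/matrixP => i j; rewrite !mxE; ring.
  rewrite mxtrace_traceless_const //; last first.
    apply: (nearU _ _ (2 * r)) => //; first by lra.
    apply: near_add => i j; apply: lt_le_trans (scal_small _ _ dc i j) _; lra.
  have dc4 : normc (d + c') < 4 * r by lra.
  by rewrite phiE // Hb // raddfD /= mxtrace_scalar mulr_natl.
have := shift c cr; have := shift 0; rewrite normc0 raddf0 !addr0 => /(_ r0) e1.
have -> : F (q + c%:M) = F q + s%:M by rewrite -es subrKC.
have sn : s *+ n.+1 = n.+1%:R * s by rewrite mulr_natl.
rewrite raddfD /= e1 mxtrace_scalar sn -addrA => /addrI.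
by rewrite -mulrDr => /(mulfI n0); rewrite conj_ifD mulrDr => /addrI ->.
Qed.

End Isometry.
End LocalStructure.

(** * From local affine forms to a global linear map *)

Section Global.
Variable n : nat.
Local Notation C := R[i].
Local Notation M := 'M[C]_n.+1.
Variables (U : M -> Prop) (F : M -> M).
Hypotheses (oU : mxopen U) (dF : forall x, U x -> exists L, is_diff U F x L)
  (isoF : forall x y, U x -> U y -> specrad (F x - F y) = specrad (x - y)).

(** The normalization that makes [F] commute with small scalar translations; the conjugation comes
    after the division by [g]. *)
Definition twist (g : C) (b : bool) (x : M) : M := map_mx (conj_if b) (g^-1 *: x).
Definition untwist (g : C) (b : bool) (x : M) : M := g *: map_mx (conj_if b) x.

Lemma twistK g b : g != 0 -> cancel (twist g b) (untwist g b).
Proof.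
by move=> g0 x; apply/matrixP => i j; rewrite !mxE conj_ifK mulrA divff // mul1r.
Qed.

Lemma twistB g b x y : twist g b (x - y) = twist g b x - twist g b y.
Proof.
by apply/matrixP => i j; rewrite !mxE mulrBr; case: b; rewrite //= rmorphB.
Qed.

Lemma untwist_real_linear g b (L : {linear 'M[C]_n.+1 -> 'M[C]_n.+1}) :
  real_linear (fun x : M => untwist g b (L x)).
Proof.
split=> [x y|t x]; rewrite ?linearD ?linearZ; apply/matrixP => i j; rewrite !mxE.
  by rewrite conj_ifD mulrDr.
by rewrite conj_ifM conj_if_real mulrCA.
Qed.

Lemma specrad_twist g b (x : M) : normc g = 1 -> specrad (twist g b x) = specrad x.
Proof. by move=> g1; rewrite specrad_conj_if specradZ normcV g1 invr1 mul1r. Qed.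

Lemma local_form x0 : U x0 -> exists2 d : R, 0 < d &
  exists2 g : C, normc g = 1 & exists b (L : {linear 'M[C]_n.+1 -> 'M[C]_n.+1}),
  forall x, mxnear d x x0 -> [/\ U x, twist g b (F x - F x0) = L (x - x0) &
    forall c, normc c < d -> specrad (c%:M + L (x - x0)) = specrad (c%:M + (x - x0))].
Proof.
move=> Ux0; have [r r0 [g g1 [b Hr]]] := local_scalar oU dF isoF Ux0.
have g0 : g != 0 by rewrite -normc_gt0 g1.
pose G x := twist g b (F x).
have HG x y c : mxnear r x x0 -> mxnear r y x0 -> normc c < r ->
    specrad (c%:M + (G x - G y)) = specrad (c%:M + (x - y)).
  move=> xx yy cr; have [Ux Uxc Fxc] := Hr x c xx cr; have [Uy _ _] := Hr y c yy cr.
  have -> : c%:M + (G x - G y) = twist g b (F (x + c%:M) - F y).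
    have -> : F (x + c%:M) - F y = (g * conj_if b c)%:M + (F x - F y).
      by rewrite Fxc addrAC addrC.
    rewrite /G -twistB; apply/matrixP => i j.
    rewrite !mxE [in RHS]mulrDr [in RHS]conj_ifD; congr (_ + _).
    case: (i == j); rewrite ?mulr1n ?mulr0n ?mulr0; last first.
      by case: (b); [apply/esym/rmorph0 | ].
    by rewrite mulKf // conj_ifK.
  rewrite (specrad_twist b _ g1) (isoF Uxc Uy); congr specrad.
  by rewrite addrAC addrC.
have [d d0 [L HL]] := specrad_local_linear r0 HG.
have dr : Num.min d r <= d by rewrite ge_min lexx.
have rr : Num.min d r <= r by rewrite ge_min lexx orbT.
exists (Num.min d r); first by rewrite lt_min d0.
exists g => //; exists b, L => x xx.
have xd := HL x (mxnear_le dr xx); have xr := mxnear_le rr xx.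
have [Ux _ _] : [/\ U x, U (x + 0%:M) & F (x + 0%:M) = F x + (g * conj_if b 0)%:M].
  by apply: Hr; rewrite ?normc0.
split; [exact: Ux | by rewrite twistB xd | ].
move=> c cd; rewrite -xd; apply: (HG x x0 c xr (mxnear_refl x0 r0)).
exact: lt_le_trans cd rr.
Qed.

Lemma local_affine x0 : U x0 -> exists2 d : R, 0 < d &
  exists2 T, real_linear T & forall x, mxnear d x x0 -> U x /\ F x - F x0 = T (x - x0).
Proof.
move=> /local_form [d d0 [g g1 [b [L HL]]]]; exists d => //.
have g0 : g != 0 by rewrite -normc_gt0 g1.
exists (fun x => untwist g b (L x)); first exact: untwist_real_linear.
by move=> x /HL [Ux e _]; split=> //; rewrite -e twistK.
Qed.

Lemma real_linear_ext (S T : M -> M) (d : R) : real_linear S -> real_linear T -> 0 < d ->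
  (forall h : M, (forall i j, normc (h i j) < d) -> S h = T h) -> S =1 T.
Proof.
move=> [_ SZ] [_ TZ] d0 ST h; have [s s0 hs] := small_multiple h d0.
have := ST _ (hs s s0 (lexx _)); rewrite SZ TZ; apply: scalerI.
by apply: realc_neq0; rewrite gt_eqF.
Qed.

Hypothesis cU : forall A B : M -> Prop, mxopen A -> mxopen B ->
  (forall x, U x -> A x \/ B x) -> (exists x, U x /\ A x) -> (exists x, U x /\ B x) ->
  exists x, U x /\ A x /\ B x.
Hypotheses (U0 : U 0) (F0 : F 0 = 0).

(** [U] splits into the points near which [F] is [T] and the others. The second set is open too: if
    [F] is affine around [x] and equals [T] near some [y] in that neighbourhood, both linear parts
    agree on small increments, hence everywhere, and [F] is [T] around [x]. *)
Lemma global_linear T d : real_linear T -> 0 < d ->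
    (forall x, mxnear d x 0 -> U x /\ F x = T x) ->
  forall x, U x -> F x = T x.
Proof.
move=> rT d0 HT; pose A x := exists2 e : R, 0 < e & forall y, mxnear e y x -> U y /\ F y = T y.
pose B x := U x /\ ~ A x.
have oA : mxopen A.
  move=> x [e e0 He]; have e2 : 0 < e / 2 by rewrite divr_gt0.
  exists (e / 2) => // y yx; exists (e / 2) => // z zy; apply: He.
  by apply: mxnear_le (mxnear_trans zy yx); lra.
have oB : mxopen B.
  move=> x [Ux nA]; have [e e0 [S rS HS]] := local_affine Ux.
  exists e => // y yx; split; first by have [] := HS y yx.
  move=> [e' e'0 He']; apply: nA; exists e => // z zx; split; first by have [] := HS z zx.
  have [del del0 yd] : exists2 del : R, 0 < del & forall z, mxnear del z y -> mxnear e z x.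
    pose f (p : 'I_n.+1 * 'I_n.+1) := e - normc (y p.1 p.2 - x p.1 p.2).
    have [del del0 Hdel] := @pos_family_lb _ _ f
      (fun p => eq_ind_r is_true (yx p.1 p.2) (subr_gt0 _ _)).
    exists del => // w wy i j; have := Hdel (i, j); rewrite /f /= => le.
    have -> : w i j - x i j = (w i j - y i j) + (y i j - x i j) by ring.
    by apply: le_lt_trans (normc_triangle _ _) _; have := wy i j; lra.
  have ST : S =1 T.
    apply: (@real_linear_ext _ _ (Num.min del e')) => //; first by rewrite lt_min del0.
    move=> h hm; have yh : mxnear (Num.min del e') (y + h) y by apply: near_add.
    have y1 : mxnear e (y + h) x by apply/yd/mxnear_le/yh; rewrite ge_min lexx.
    have y2 : mxnear e' (y + h) y by apply: mxnear_le yh; rewrite ge_min lexx orbT.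
    have [_ Fyh] := He' _ y2; have [_ Fy] := He' _ (mxnear_refl y e'0).
    have [_ Sh] := HS _ y1; have [_ Sy] := HS _ yx.
    have -> : h = (y + h - x) - (y - x) by apply/matrixP => i j; rewrite !mxE; ring.
    rewrite (real_linearB _ _ rS) -Sh -Sy (real_linearB _ _ rT) !(real_linearB _ _ rT).
    by rewrite Fyh Fy; apply/matrixP => i j; rewrite !mxE; ring.
  have [_ Fy] := He' _ (mxnear_refl y e'0).
  have [_ Sy] := HS _ yx; have [_ Sz] := HS _ zx.
  have Fx : F x = T x.
    have -> : F x = F y - (F y - F x) by rewrite opprB addrC subrK.
    by rewrite Sy ST (real_linearB _ _ rT) Fy opprB addrC subrK.
  have -> : F z = F z - F x + F x by rewrite subrK.
  by rewrite Sz ST (real_linearB _ _ rT) Fx subrK.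
have AB x : U x -> A x \/ B x.
  by move=> Ux; have [a|a] := pselect (A x); [left | right].
move=> x Ux; have [a|nA] := pselect (A x).
  by have [e e0 He] := a; have [] := He _ (mxnear_refl x e0).
have [||y [_ [Ay [_ nAy]]]] := cU oA oB AB; last by [].
  by exists 0; split=> //; exists d.
by exists x.
Qed.

Lemma specrad_isometry_form : exists2 g : C, normc g = 1 & exists b,
  exists2 u, u \in unitmx &
  (forall x, U x -> twist g b (F x) = u *m x *m invmx u) \/
  (forall x, U x -> twist g b (F x) = u *m x^T *m invmx u).
Proof.
have [d d0 [g g1 [b [L HL]]]] := local_form U0.
have g0 : g != 0 by rewrite -normc_gt0 g1.
have rL := untwist_real_linear g b L.
have FL x : U x -> F x = untwist g b (L x).
  apply: (global_linear rL d0) => y /HL [Uy e _]; split=> //.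
  by rewrite F0 !subr0 in e; rewrite -e twistK.
have tL x : U x -> twist g b (F x) = L x.
  move=> Ux; rewrite FL //; apply/matrixP => i j.
  by rewrite !mxE mulKf // conj_ifK.
exists g => //; exists b.
have [|u uu Hu] := @specrad_linear_form _ _ L; last first.
  by exists u => //; case: Hu => Hu; [left | right] => x Ux; rewrite tL // Hu.
(* [HL] holds only near 0; [c] and [h] are shrunk by the same positive [s], which homogeneity of the
   spectral radius removes. *)
move=> c h; have [s1 s10 H1] := small_multiple h d0.
have [s2 s20 H2] := small_multiple (c%:M : M) d0.
pose s := Num.min s1 s2; have s0 : 0 < s by rewrite lt_min s10.
have sC : s%:C != 0 :> C by apply: realc_neq0; rewrite gt_eqF.
have hs := H1 s s0 (_ : s <= s1); have cs := H2 s s0 (_ : s <= s2).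
have nh : mxnear d (s%:C *: h) 0.
  by move=> i j; rewrite [in X in _ - X]mxE subr0; apply: hs; rewrite ge_min lexx.
have nc : normc (s%:C * c) < d.
  have := cs _ 0 0; rewrite ge_min lexx orbT => /(_ isT).
  by rewrite !mxE eqxx mulr1n.
have [_ _ H] := HL _ nh; have := H _ nc; rewrite subr0 linearZ /=.
rewrite -scale_scalar_mx -!scalerDr !specradZ; apply: mulfI.
by rewrite normc_eq0.
Qed.

End Global.

(** * Transfer to matrices as functions *)

Section Transfer.
Local Notation C := R[i].

Definition toC (z : Cplx) : C := z.1 +i* z.2.
Definition ofC (z : C) : Cplx := (Re z, Im z).

Lemma toCK : cancel toC ofC. Proof. by case. Qed.
Lemma ofCK : cancel ofC toC. Proof. by case. Qed.
Lemma toC_add z w : toC (Cadd z w) = toC z + toC w. Proof. by []. Qed.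
Lemma toC_mul z w : toC (Cmul z w) = toC z * toC w. Proof. by []. Qed.
Lemma Cmod_normc z : Cmod z = normc (toC z).
Proof. by rewrite /Cmod RsqrtE /normc /= !expr2. Qed.

Lemma toC_inv z : toC (Cinv z) = (toC z)^-1.
Proof.
case: z => a b; rewrite /Cinv /toC /= !RdivE.
by rewrite -[RHS]/(a / (a ^+ 2 + b ^+ 2) +i* - (b / (a ^+ 2 + b ^+ 2))) !expr2 -mulNr.
Qed.

Lemma RmaxF : Rmax = Num.max.
Proof. by apply/funext => x; apply/funext => y; apply: RmaxE. Qed.

Variable n : nat.
Local Notation M := 'M[C]_n.+1.

Definition toM (A : Mat n.+1) : M := \matrix_(i, j) toC (A i j).
Definition ofM (X : M) : Mat n.+1 := fun i j => ofC (X i j).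

Lemma toMK : cancel toM ofM.
Proof.
move=> A; apply/funext => i; apply/funext => j.
by rewrite /ofM mxE toCK.
Qed.

Lemma ofMK : cancel ofM toM.
Proof. by move=> X; apply/matrixP => i j; rewrite mxE ofCK. Qed.

Lemma toM_add A B : toM (madd A B) = toM A + toM B.
Proof. by apply/matrixP => i j; rewrite !mxE. Qed.

Lemma toM_sub A B : toM (msub A B) = toM A - toM B.
Proof. by apply/matrixP => i j; rewrite !mxE. Qed.

Lemma toM_zero : toM (mzero n.+1) = 0.
Proof. by apply/matrixP => i j; rewrite !mxE. Qed.

Lemma toM_scale c A : toM (mscale c A) = toC c *: toM A.
Proof. by apply/matrixP => i j; rewrite !mxE toC_mul. Qed.

Lemma toM_tr A : toM (mtr A) = (toM A)^T.
Proof. by apply/matrixP => i j; rewrite !mxE. Qed.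

Lemma toC_big (f : 'I_n.+1 -> Cplx) :
  toC (\big[Cadd/C0]_(k < n.+1) f k) = \sum_k toC (f k).
Proof. exact: (big_morph toC toC_add). Qed.

Lemma toM_mul A B : toM (mmul A B) = toM A *m toM B.
Proof.
apply/matrixP => i j; rewrite !mxE toC_big; apply: eq_bigr => k _.
by rewrite !mxE toC_mul.
Qed.

Lemma toM_id : toM (mid n.+1) = 1%:M.
Proof. by apply/matrixP => i j; rewrite !mxE /mid; case: (i == j). Qed.

Lemma mnorm_ub (A : Mat n.+1) i j : normc (toM A i j) <= mnorm A.
Proof.
rewrite mxE -Cmod_normc /mnorm RmaxF.
apply: le_trans (le_bigmax _ (fun i => \big[Num.max/0]_j Cmod (A i j)) i).
exact: (le_bigmax _ (fun j => Cmod (A i j)) j).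
Qed.

Lemma mnorm_le (A : Mat n.+1) (t : R) :
  (forall i j, normc (toM A i j) <= t) -> mnorm A <= t.
Proof.
move=> H; have t0 : 0 <= t by apply: le_trans (normc_ge0 _) (H 0 0).
rewrite /mnorm RmaxF; apply: bigmax_le => // i _; apply: bigmax_le => // j _.
by have := H i j; rewrite mxE Cmod_normc.
Qed.

Lemma mnorm_lt (A : Mat n.+1) (t : R) :
  (forall i j, normc (toM A i j) < t) -> mnorm A < t.
Proof.
move=> H; have t0 : 0 < t by apply: le_lt_trans (normc_ge0 _) (H 0 0).
rewrite /mnorm RmaxF; apply: bigmax_lt => // i _; apply: bigmax_lt => // j _.
by have := H i j; rewrite mxE Cmod_normc.
Qed.

(** This reconciles eigenvalues defined by row vectors with those defined by column vectors. *)
Lemma eigenvalue_tr (X : M) z : eigenvalue X^T z = eigenvalue X z.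
Proof.
rewrite !eigenvalue_root_char /root !horner_char_poly.
by rewrite -[in RHS]det_tr linearB /= tr_scalar_mx.
Qed.

Lemma toM_eigenvalue A l : Defs.eigenvalue A l <-> eigenvalue (toM A) (toC l).
Proof.
rewrite -eigenvalue_tr; split=> [[v [[i vi] Av]]|/eigenvalueP [w Aw w0]].
  apply/eigenvalueP; exists (\row_j toC (v j)).
    apply/rowP => j; rewrite !mxE -toC_mul -Av toC_big; apply: eq_bigr => k _.
    by rewrite !mxE toC_mul mulrC.
  apply/eqP => /rowP /(_ i); rewrite !mxE => vi0; apply: vi.
  by rewrite -[v i]toCK vi0.
exists (fun j => ofC (w 0 j)); split.
  have [i wi] := rV0Pn _ w0; exists i => e; move: wi.
  by rewrite -[w 0 i]ofCK e eqxx.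
move=> i; apply: (can_inj toCK); rewrite toC_big toC_mul ofCK.
have /rowP /(_ i) := Aw; rewrite !mxE => <-; apply: eq_bigr => k _.
by rewrite !mxE toC_mul ofCK mulrC.
Qed.

(** The set of moduli has [specrad] as a least upper bound, so [epsilon] picks a least upper bound,
    and these are unique. *)
Lemma rho_specrad A : rho A = specrad (toM A).
Proof.
pose E (t : R) := exists l, Defs.eigenvalue A l /\ t = Cmod l.
have lubE : is_lub E (specrad (toM A)).
  split=> [t [l [/toM_eigenvalue lA ->]]|b ub].
    by apply/RleP; rewrite Cmod_normc; apply: specrad_ub.
  have [z zA <-] := specrad_attained (toM A); apply: ub; exists (ofC z).
  by split; [apply/toM_eigenvalue; rewrite ofCK | rewrite Cmod_normc ofCK].
have [ub1 le1] := epsilon_spec (inhabits (IZR 0)) (is_lub E) (ex_intro _ _ lubE).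
have [ub2 le2] := lubE.
by apply: Rle_antisym; [apply: le1 | apply: le2].
Qed.

End Transfer.

Section TransferHypotheses.
Variables (n : nat) (U : Mat n.+1 -> Prop) (F : Mat n.+1 -> Mat n.+1).
Local Notation C := R[i].
Local Notation M := 'M[C]_n.+1.
Let U' (x : M) := U (ofM x).
Let F' (x : M) := toM (F (ofM x)).

Lemma mxnear_mnorm (A B : Mat n.+1) (r : R) :
  Rlt (mnorm (msub A B)) r -> mxnear r (toM A) (toM B).
Proof.
move=> /RltP AB i j; apply: le_lt_trans AB.
by have := mnorm_ub (msub A B) i j; rewrite toM_sub !mxE.
Qed.

Lemma mnorm_mxnear (x y : M) (r : R) : mxnear r x y -> Rlt (mnorm (msub (ofM x) (ofM y))) r.
Proof.
move=> xy; apply/RltP/mnorm_lt => i j.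
by rewrite toM_sub !ofMK !mxE; apply: xy.
Qed.

Lemma open_set_mxopen (A : Mat n.+1 -> Prop) :
  Defs.open_set A -> mxopen (fun x : M => A (ofM x)).
Proof.
move=> oA x /oA [e [/RltP e0 He]]; exists e => // y yx.
by apply: He; apply: mnorm_mxnear.
Qed.

Lemma mxopen_open_set (A : M -> Prop) :
  mxopen A -> Defs.open_set (fun x : Mat n.+1 => A (toM x)).
Proof.
move=> oA x /oA [e e0 He]; exists e; split; first exact/RltP.
by move=> y /mxnear_mnorm; apply: He.
Qed.

Lemma connected_set_mx : connected_set U -> forall A B : M -> Prop,
  mxopen A -> mxopen B -> (forall x, U' x -> A x \/ B x) ->
  (exists x, U' x /\ A x) -> (exists x, U' x /\ B x) ->
  exists x, U' x /\ A x /\ B x.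
Proof.
move=> cU A B oA oB AB [a [Ua Aa]] [b [Ub Bb]].
have [|||x [Ux ABx]] := cU _ _ (mxopen_open_set oA) (mxopen_open_set oB).
- by move=> x Ux; apply: AB; rewrite /U' toMK.
- by exists (ofM a); rewrite ofMK.
- by exists (ofM b); rewrite ofMK.
by exists (toM x); rewrite /U' toMK.
Qed.

Lemma C1_on_is_diff : C1_on U F -> forall x, U' x -> exists L, is_diff U' F' x L.
Proof.
move=> [DF [dF _]] x Ux; have [[LD LZ] dL] := dF _ Ux.
exists (fun h => toM (DF (ofM x) (ofM h))); split; first split.
- move=> a b; rewrite -toM_add -LD; congr (toM (DF _ _)).
  by apply: (can_inj (@toMK n)); rewrite toM_add !ofMK.
- move=> t a; have -> : t%:C = toC (RtoC t) by [].
  rewrite -toM_scale -[mscale _ _]/(mRscale t (DF (ofM x) (ofM a))) -LZ.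
  congr (toM (DF _ _)).
  by apply: (can_inj (@toMK n)); rewrite /mRscale toM_scale !ofMK.
move=> e e0; have [d [/RltP d0 Hd]] := dL e (RltP e0); exists d => // h t td ht Uxh i j.
have e1 : madd (ofM x) (ofM h) = ofM (x + h).
  by apply: (can_inj (@toMK n)); rewrite toM_add !ofMK.
have hh : mnorm (ofM h) <= t by apply: mnorm_le => k l; rewrite ofMK.
have := Hd (ofM h); rewrite e1 => H.
have {H} /RleP H := H (RltP (le_lt_trans hh td)) Uxh.
have := le_trans (mnorm_ub _ i j) H; rewrite !toM_sub => {}H.
apply: le_trans H _; by rewrite RmultE ler_pM2l.
Qed.

End TransferHypotheses.

Local Open Scope R_scope.

Theorem theorem6 (n : nat) (Hn : (0 < n)%N) (U : Mat n -> Prop)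
  (F : Mat n -> Mat n) :
  domain U -> U (mzero n) -> C1_on U F -> F (mzero n) = mzero n ->
  (forall x y, U x -> U y -> rho (msub (F x) (F y)) = rho (msub x y)) ->
  exists (g : Cplx) (u v : Mat n),
    Cmod g = 1 /\ mmul u v = mid n /\ mmul v u = mid n /\
    exists H : Mat n -> Mat n,
      (H = (fun x => mscale (Cinv g) (F x)) \/
       H = (fun x => mscale (Cinv g) (mconj (F x)))) /\
      ((forall x, U x -> H x = mmul (mmul u x) v) \/
       (forall x, U x -> H x = mmul (mmul u (mtr x)) v)).
Proof.
case: n Hn U F => // n _ U F [_ [oU cU]] U0 dF F0 isoF.
have toMI := can_inj (@toMK n).
have ofM0 : ofM 0 = mzero n.+1 by apply: toMI; rewrite ofMK toM_zero.
have isoF' x y : U (ofM x) -> U (ofM y) ->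
    specrad (toM (F (ofM x)) - toM (F (ofM y))) = specrad (x - y).
  move=> Ux Uy; have := isoF _ _ Ux Uy.
  by rewrite !rho_specrad !toM_sub !ofMK.
have [||g g1 [b [u uu Hu]]] := specrad_isometry_form (open_set_mxopen oU)
  (C1_on_is_diff dF) isoF' (connected_set_mx cU).
- by rewrite ofM0.
- by rewrite ofM0 F0 toM_zero.
pose H x := ofM (twist g b (toM (F x))).
(* [twist] conjugates after dividing, the conclusion divides after conjugating; so the constant is
   the conjugate of [g] when [b] holds. *)
exists (ofC (conj_if b g)), (ofM u), (ofM (invmx u)); split.
  by rewrite Cmod_normc ofCK normc_conj_if.
split; first by apply: toMI; rewrite toM_mul !ofMK mulmxV // toM_id.
split; first by apply: toMI; rewrite toM_mul !ofMK mulVmx // toM_id.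
exists H; split; last first.
  have UofM x : U x -> U (ofM (toM x)) by rewrite toMK.
  case: Hu => Hu; [left | right] => x /UofM /Hu e; apply: toMI;
    rewrite toMK in e; rewrite /H ofMK e !toM_mul !ofMK; first by [].
  by rewrite toM_tr.
case: b {Hu} @H; [right | left]; apply/funext => x; apply: toMI;
  rewrite ofMK toM_scale toC_inv ofCK; apply/matrixP => i j; rewrite !mxE //.
by rewrite /conj_if rmorphM fmorphV.
Qed.
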